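(* Let $Q$ be a finite acyclic quiver which is connected and not a Dynkin quiver. Then for each dimension vector $w$, the graded affine quiver variety $\mathcal{M}_0(w)$ associated with $Q$ is isomorphic to an affine space.
   Context: $k=\mathbb{C}$; a Dynkin quiver is one whose underlying graph is a (disjoint union of) ADE Dynkin diagram(s). Repetition quiver: for a quiver $Q$, $\mathbb{Z}Q$ has vertices $(i,p)$, $i\in Q_0$, $p\in\mathbb{Z}$, and for each arrow $\alpha:i\to j$ and $p\in\mathbb{Z}$ arrows $(\alpha,p):(i,p)\to(j,p)$ and $\sigma(\alpha,p):(j,p-1)\to(i,p)$. Put $\tau(i,p)=(i,p-1)$, and for an arrow $\beta$ put $\sigma(\beta)=\sigma(\alpha,p)$ if $\beta=(\alpha,p)$ and $\sigma(\beta)=(\alpha,p-1)$ if $\beta=\sigma(\alpha,p)$. The mesh relator $r_x$ is the sum over all arrows $\beta:y\to x$ of the paths $\tau(x)\xrightarrow{\sigma(\beta)}y\xrightarrow{\beta}x$. Nakajima categories: the framed quiver $\tilde{Q}$ is obtained from $Q$ by adding for each $i\in Q_0$ a new vertex $i'$ and an arrow $i\to i'$. The vertices $(i',p)$ of $\mathbb{Z}\tilde{Q}$ are frozen, the vertices $(i,p)$, $i\in Q_0$, are non frozen. The category $\mathcal{R}$ has as objects the vertices of $\mathbb{Z}\tilde{Q}$ and as morphisms linear combinations of paths modulo the ideal generated by the $r_x$ for non frozen $x$ only. The singular Nakajima category $\mathcal{S}$ is the full subcategory of $\mathcal{R}$ on the frozen vertices; $\mathcal{S}_0$ is its set of objects.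 An $\mathcal{S}$-module is a $k$-linear functor $\mathcal{S}^{op}\to\mathrm{Mod}\,k$. A dimension vector is a function $w:\mathcal{S}_0\to\mathbb{N}$ with finite support. The affine graded quiver variety $\mathcal{M}_0(w)$ is the set of $\mathcal{S}$-modules $M$ with $M(u)=k^{w(u)}$ for all $u\in\mathcal{S}_0$, with its structure of affine variety as a Zariski closed subset of the finite-dimensional affine space $\prod_{u_1,u_2\in\mathcal{S}_0}\mathrm{Hom}_k(\mathrm{Hom}_{\mathcal{S}}(u_1,u_2),k^{w(u_2)\times w(u_1)})$. *)

(* Defs.v *)
From HB Require Import structures.
From mathcomp Require Import all_boot all_order all_algebra.
From mathcomp Require Import generic_quotient ring_quotient.
From mathcomp Require Import finmap monalg.
From mathcomp Require Import boolp.

Set Implicit Arguments.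
Unset Strict Implicit.
Unset Printing Implicit Defensive.

Import GRing.Theory.
Local Open Scope ring_scope.
Local Open Scope quotient_scope.

Record quiver := Quiver {
  vert : choiceType;
  arr : choiceType;
  src : arr -> vert;
  tgt : arr -> vert
}.

Record finquiver := FinQuiver {
  fvert : finType;
  farr : finType;
  fsrc : farr -> fvert;
  ftgt : farr -> fvert
}.

Coercion quiver_of (Q : finquiver) : quiver := Quiver (@fsrc Q) (@ftgt Q).

(* Paths are listed in the order in which they are travelled; the empty
   sequence is the trivial path. *)
Fixpoint is_path (Q : quiver) (x y : vert Q) (s : seq (arr Q)) : bool :=
  if s is a :: s' then (src a == x) && is_path (tgt a) y s' else x == y.

Definition qpath (Q : quiver) (x y : vert Q) : choiceType :=
  {s : seq (arr Q) | is_path x y s}.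

Lemma is_path_cat (Q : quiver) (x y z : vert Q) s t :
  is_path x y s -> is_path y z t -> is_path x z (s ++ t).
Proof.
elim: s x => [|a s IHs] x /=; first by move=> /eqP ->.
by case/andP=> -> ps pt; apply: IHs.
Qed.

Definition nil_path (Q : quiver) (x : vert Q) : qpath x x :=
  exist _ [::] (eqxx x).

Definition cat_path (Q : quiver) (x y z : vert Q)
    (p : qpath x y) (q : qpath y z) : qpath x z :=
  exist _ (val p ++ val q) (is_path_cat (valP p) (valP q)).

Definition acyclic (Q : finquiver) : Prop :=
  forall (x : vert Q) (s : seq (arr Q)), is_path x x s -> s = [::].

Definition joined (Q : finquiver) (i j : fvert Q) (a : farr Q) : bool :=
  ((fsrc a == i) && (ftgt a == j)) || ((fsrc a == j) && (ftgt a == i)).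

Definition connected_quiver (Q : finquiver) : Prop :=
  (0 < #|fvert Q|)%N /\
  forall i j : fvert Q, connect (fun x y => [exists a, joined x y a]) i j.

(* TypeA n, TypeD n and TypeE m stand for A_(n+1), D_(n+4) and E_(m+6). *)
Inductive ade := TypeA of nat | TypeD of nat | TypeE of 'I_3.

Definition ade_rank (T : ade) : nat :=
  match T with TypeA n => n.+1 | TypeD n => n.+4 | TypeE m => (m + 6)%N end.

(* The vertices are 0, ..., rank - 1.  In types D and E the vertices
   0, ..., rank - 2 form a chain, to which the last vertex is attached at the
   vertex rank - 3 in type D and at the vertex 2 in type E. *)
Definition ade_edge (T : ade) (a b : nat) : bool :=
  match T with
  | TypeA n => b == a.+1
  | TypeD n => (b == a.+1) && (b < n.+3)%N || ((a == n.+1) && (b == n.+3))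
  | TypeE m => (b == a.+1) && (b < m + 5)%N || ((a == 2) && (b == m + 5))%N
  end.

Definition ade_adj (T : ade) (a b : nat) : bool :=
  ade_edge T a b || ade_edge T b a.

Definition ade_union_adj N (T : 'I_N -> ade)
    (x y : {m : 'I_N & 'I_(ade_rank (T m))}) : bool :=
  (tag x == tag y) && ade_adj (T (tag x)) (tagged x) (tagged y).

(* The ADE diagrams are simple graphs, so the underlying graph of a Dynkin
   quiver has at most one edge between two vertices, and no loop. *)
Definition dynkin (Q : finquiver) : Prop :=
  exists N (T : 'I_N -> ade) (f : fvert Q -> {m : 'I_N & 'I_(ade_rank (T m))}),
    bijective f /\
    forall i j, #|[set a | joined i j a]| = ade_union_adj (f i) (f j) :> nat.

(* inl i is the vertex i and inr i is the new vertex i'; the arrow inr i is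
   i -> i'. *)
Definition framed (Q : finquiver) : finquiver :=
  @FinQuiver (fvert Q + fvert Q)%type (farr Q + fvert Q)%type
    (fun a => match a with inl b => inl (fsrc b) | inr i => inl i end)
    (fun a => match a with inl b => inl (ftgt b) | inr i => inr i end).

(* inl (a, p) is the arrow (a, p) and inr (a, p) is the arrow sigma(a, p). *)
Definition repetition (Q : finquiver) : quiver :=
  @Quiver (fvert Q * int)%type ((farr Q * int) + (farr Q * int))%type
    (fun b => match b with
      | inl (a, p) => (fsrc a, p)
      | inr (a, p) => (ftgt a, p - 1)
      end)
    (fun b => match b with
      | inl (a, p) => (ftgt a, p)
      | inr (a, p) => (fsrc a, p)
      end).

Definition tau (Q : finquiver) (x : vert (repetition Q)) :
  vert (repetition Q) := (x.1, x.2 - 1).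

Definition sigma (Q : finquiver) (b : arr (repetition Q)) :
    arr (repetition Q) :=
  match b with inl (a, p) => inr (a, p) | inr (a, p) => inl (a, p - 1) end.

Definition arrows_into (Q : finquiver) (x : vert (repetition Q)) :
    seq (arr (repetition Q)) :=
  [seq inl (a, x.2) | a <- enum (farr Q) & ftgt a == x.1] ++
  [seq inr (a, x.2) | a <- enum (farr Q) & fsrc a == x.1].

Lemma arrows_into_uniq (Q : finquiver) (x : vert (repetition Q)) :
  uniq (arrows_into x).
Proof.
rewrite cat_uniq; apply/and3P; split.
- by rewrite map_inj_uniq => [|a b [] //]; apply/filter_uniq/enum_uniq.
- by apply/hasPn => _ /mapP[a _ ->]; apply/mapP; case.
- by rewrite map_inj_uniq => [|a b [] //]; apply/filter_uniq/enum_uniq.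
Qed.

Lemma mem_arrows_into (Q : finquiver) (x : vert (repetition Q)) b :
  (b \in arrows_into x) = (tgt b == x).
Proof.
case: x => i p; rewrite mem_cat; apply/orP/eqP => /=.
  by case=> /mapP[a]; rewrite mem_filter => /andP[/eqP ai _] ->; rewrite /= ai.
by case: b => -[a q] /= [<- <-]; [left|right]; apply/mapP;
  exists a => //; rewrite mem_filter eqxx mem_enum.
Qed.

Lemma mesh_path (Q : finquiver) (x : vert (repetition Q)) b :
  tgt b = x -> is_path (tau x) x [:: sigma b; b].
Proof. by move=> <-; case: b => -[a p]; rewrite /= /tau /= !eqxx. Qed.

Record lincat (k : fieldType) := LinCat {
  obj :> Type;
  hom : obj -> obj -> lmodType k;
  idm : forall x, hom x x;
  comp : forall x y z, hom y z -> hom x y -> hom x z;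
  comp_linearl : forall x y z (f : hom x y),
    linear (fun g : hom y z => comp g f);
  comp_linearr : forall x y z (g : hom y z),
    linear (fun f : hom x y => comp g f);
  comp1m : forall x y (f : hom x y), comp (idm y) f = f;
  compm1 : forall x y (f : hom x y), comp f (idm x) = f;
  compA : forall x y z t (h : hom z t) (g : hom y z) (f : hom x y),
    comp h (comp g f) = comp (comp h g) f
}.

Definition full_subcat (k : fieldType) (C : lincat k) (T : Type) (F : T -> C) :
    lincat k :=
  @LinCat k T (fun u v => hom (F u) (F v)) (fun u => idm (F u))
    (fun u v w => @comp k C (F u) (F v) (F w))
    (fun u v w => @comp_linearl k C (F u) (F v) (F w))
    (fun u v w => @comp_linearr k C (F u) (F v) (F w))
    (fun u v => @comp1m k C (F u) (F v))
    (fun u v => @compm1 k C (F u) (F v))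
    (fun u v w t => @compA k C (F u) (F v) (F w) (F t)).

Section LinearExtension.
Variables (k : fieldType) (K : choiceType) (V : lmodType k) (h : K -> V).

Definition linext (f : {malg k[K]}) : V := \sum_(p <- msupp f) f@_p *: h p.

Lemma linextEw (d : {fset K}) f : (msupp f `<=` d)%fset ->
  linext f = \sum_(p <- d) f@_p *: h p.
Proof.
move=> fd; apply: big_fset_incl => // p _ /mcoeff_outdom ->.
by rewrite scale0r.
Qed.

Lemma linext_is_linear : linear linext.
Proof.
move=> c f g; pose d := (msupp f `|` msupp g `|` msupp (c *: f + g))%fset.
have sf : (msupp f `<=` d)%fset by rewrite /d -fsetUA fsubsetUl.
have sg : (msupp g `<=` d)%fset.
  by rewrite /d -fsetUA fsetUCA fsubsetUl.
have sh : (msupp (c *: f + g) `<=` d)%fset by rewrite /d fsubsetUr.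
rewrite (linextEw sf) (linextEw sg) (linextEw sh) scaler_sumr -big_split /=.
by apply: eq_bigr => p _; rewrite mcoeffD mcoeffZ scalerDl scalerA.
Qed.

HB.instance Definition _ :=
  GRing.isLinear.Build k {malg k[K]} V *:%R linext linext_is_linear.

Lemma linextU p : linext << p >> = h p.
Proof.
by rewrite (linextEw msuppU_le) big_seq_fset1 mcoeffUU scale1r.
Qed.

End LinearExtension.

Lemma linext_id (k : fieldType) (K : choiceType) (f : {malg k[K]}) :
  linext (fun p => << p >> : {malg k[K]}) f = f.
Proof.
rewrite [RHS]monalgE; apply: eq_bigr => p _; apply/malgP=> q.
by rewrite mcoeffZ !mcoeffU mulrnAr mulr1.
Qed.

Lemma eq_linext (k : fieldType) (K : choiceType) (V : lmodType k)
  (h1 h2 : K -> V) (f : {malg k[K]}) : h1 =1 h2 -> linext h1 f = linext h2 f.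
Proof. by move=> h12; apply: eq_bigr => p _; rewrite h12. Qed.

Section PathCategory.
Variables (k : fieldType) (Q : quiver).
Implicit Types x y z t : vert Q.

Definition pathcomb x y : lmodType k := {malg k[qpath x y]}.

Definition pid x : pathcomb x x := << nil_path x >>.

Definition pcomp x y z (g : pathcomb y z) (f : pathcomb x y) : pathcomb x z :=
  linext (fun p => linext (fun q => << cat_path p q >>) g) f.

Lemma pcomp_linearr x y z (g : pathcomb y z) :
  linear (fun f : pathcomb x y => pcomp g f).
Proof. exact: linext_is_linear. Qed.

Lemma pcomp_linearl x y z (f : pathcomb x y) :
  linear (fun g : pathcomb y z => pcomp g f).
Proof.
move=> c g h; rewrite /pcomp /linext scaler_sumr -big_split /=.
apply: eq_bigr => p _; rewrite -!/(linext _ _) linearP /=.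
by rewrite scalerDr !scalerA mulrC.
Qed.

Lemma pcompBr x y z (g : pathcomb y z) (f f' : pathcomb x y) :
  pcomp g (f - f') = pcomp g f - pcomp g f'.
Proof.
rewrite addrC -scaleN1r [RHS]addrC -[- pcomp g f']scaleN1r.
exact: (pcomp_linearr g (-1) f' f).
Qed.

Lemma pcompBl x y z (g g' : pathcomb y z) (f : pathcomb x y) :
  pcomp (g - g') f = pcomp g f - pcomp g' f.
Proof.
rewrite addrC -scaleN1r [RHS]addrC -[- pcomp g' f]scaleN1r.
exact: (pcomp_linearl f (-1) g' g).
Qed.

Lemma pcomp1m x y (f : pathcomb x y) : pcomp (pid y) f = f.
Proof.
rewrite -[RHS]linext_id; apply: eq_linext => p; rewrite linextU.
by congr << _ >>; apply: val_inj; rewrite /= cats0.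
Qed.

Lemma pcompm1 x y (f : pathcomb x y) : pcomp f (pid x) = f.
Proof.
rewrite /pcomp linextU -[RHS]linext_id; apply: eq_linext => p.
by congr << _ >>; apply: val_inj.
Qed.

Lemma linext_linext (K L : choiceType) (V : lmodType k)
    (a : L -> V) (b : K -> {malg k[L]}) f :
  linext a (linext b f) = linext (fun p => linext a (b p)) f.
Proof.
rewrite -[linext b f]/(\sum_(p <- msupp f) f@_p *: b p) raddf_sum.
by apply: eq_bigr => p _; rewrite /= linearZ.
Qed.

Lemma pcompA x y z t (h : pathcomb z t) (g : pathcomb y z) (f : pathcomb x y) :
  pcomp h (pcomp g f) = pcomp (pcomp h g) f.
Proof.
rewrite /pcomp linext_linext; apply: eq_linext => p.
rewrite !linext_linext; apply: eq_linext => q.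
rewrite linextU linext_linext; apply: eq_linext => r.
by rewrite linextU; congr << _ >>; apply: val_inj; rewrite /= catA.
Qed.

(* The two-sided ideal generated by a family of relators. *)
Inductive ideal (rel : forall x y, pathcomb x y -> Prop) :
    forall x y, pathcomb x y -> Prop :=
  | ideal_rel x y (f : pathcomb x y) of rel x y f : ideal rel f
  | ideal0 x y : ideal rel (0 : pathcomb x y)
  | idealP x y c (f g : pathcomb x y) of ideal rel f & ideal rel g :
      ideal rel (c *: f + g)
  | ideal_compl x y z (g : pathcomb y z) (f : pathcomb x y) of ideal rel f :
      ideal rel (pcomp g f)
  | ideal_compr x y z (g : pathcomb y z) (f : pathcomb x y) of ideal rel g :
      ideal rel (pcomp g f).

Variable rel : forall x y, pathcomb x y -> Prop.

Definition in_ideal x y : {pred pathcomb x y} := [pred f | `[< ideal rel f >]].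

Lemma in_ideal_zmod x y : zmod_closed (@in_ideal x y).
Proof.
split=> [|f g /asboolP If /asboolP Ig]; apply/asboolP; first exact: ideal0.
by rewrite addrC -scaleN1r; apply: idealP.
Qed.

HB.instance Definition _ x y :=
  GRing.isZmodClosed.Build (pathcomb x y) (@in_ideal x y) (in_ideal_zmod x y).

Definition quothom x y := Quotient.quot (@in_ideal x y).

HB.instance Definition _ x y := GRing.Zmodule.on (quothom x y).

Definition qclass x y (f : pathcomb x y) : quothom x y := \pi f.

Definition qrepr x y (f : quothom x y) : pathcomb x y := repr f.

Lemma qreprK x y : cancel (@qrepr x y) (@qclass x y).
Proof. exact: reprK. Qed.

Lemma qclass_eq x y (f g : pathcomb x y) :
  qclass f = qclass g <-> ideal rel (f - g).
Proof.
split=> [fg|fg]; first apply/asboolP.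
  by have /eqP := fg; rewrite -Quotient.idealrBE.
by apply/eqP; rewrite -Quotient.idealrBE; apply/asboolP.
Qed.

Lemma qclassD x y : {morph @qclass x y : f g / f + g}.
Proof. by move=> f g; rewrite /qclass piE. Qed.

Lemma qreprE x y (f : pathcomb x y) : ideal rel (qrepr (qclass f) - f).
Proof. by apply/qclass_eq; rewrite qreprK. Qed.

Lemma ideal_scale x y c (f : pathcomb x y) : ideal rel f -> ideal rel (c *: f).
Proof. by move=> If; rewrite -[_ *: _]addr0; apply: idealP => //; apply: ideal0. Qed.

Lemma ideal_add x y (f g : pathcomb x y) :
  ideal rel f -> ideal rel g -> ideal rel (f + g).
Proof. by move=> If Ig; rewrite -[f]scale1r; apply: idealP. Qed.

Definition qscale x y (c : k) (f : quothom x y) : quothom x y :=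
  qclass (c *: qrepr f).

Lemma qscaleE x y c (f : pathcomb x y) : qscale c (qclass f) = qclass (c *: f).
Proof.
by apply/qclass_eq; rewrite -scalerBr; apply/ideal_scale/qreprE.
Qed.

Lemma qscaleA x y a b (f : quothom x y) :
  qscale a (qscale b f) = qscale (a * b) f.
Proof. by rewrite -[f]qreprK !qscaleE scalerA. Qed.

Lemma qscale1 x y : left_id 1 (@qscale x y).
Proof. by move=> f; rewrite -[f]qreprK qscaleE scale1r. Qed.

Lemma qscaleDr x y : right_distributive (@qscale x y) +%R.
Proof.
move=> c f g; rewrite -[f]qreprK -[g]qreprK.
by rewrite -qclassD !qscaleE scalerDr qclassD.
Qed.

Lemma qscaleDl x y (f : quothom x y) :
  {morph (@qscale x y)^~ f : a b / a + b}.
Proof. by move=> a b; rewrite -[f]qreprK !qscaleE -qclassD scalerDl. Qed.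

HB.instance Definition _ x y := GRing.Zmodule_isLmodule.Build k (quothom x y)
  (@qscaleA x y) (@qscale1 x y) (@qscaleDr x y) (@qscaleDl x y).

Lemma qclass_is_linear x y : linear (@qclass x y).
Proof. by move=> c f g; rewrite qclassD -qscaleE. Qed.

Definition qcomp x y z (g : quothom y z) (f : quothom x y) : quothom x z :=
  qclass (pcomp (qrepr g) (qrepr f)).

Lemma qcompE x y z (g : pathcomb y z) (f : pathcomb x y) :
  qcomp (qclass g) (qclass f) = qclass (pcomp g f).
Proof.
apply/qclass_eq; set g' := qrepr _; set f' := qrepr _.
have -> : pcomp g' f' - pcomp g f = pcomp g' (f' - f) + pcomp (g' - g) f.
  by rewrite pcompBr pcompBl addrA subrK.
by apply: ideal_add; [apply: ideal_compl|apply: ideal_compr]; apply: qreprE.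
Qed.

Lemma qcomp_linearl x y z (f : quothom x y) :
  linear (fun g : quothom y z => qcomp g f).
Proof.
move=> c g h; rewrite -[f]qreprK -[g]qreprK -[h]qreprK.
rewrite -qclass_is_linear !qcompE -qclass_is_linear; congr qclass.
exact: pcomp_linearl.
Qed.

Lemma qcomp_linearr x y z (g : quothom y z) :
  linear (fun f : quothom x y => qcomp g f).
Proof.
move=> c f h; rewrite -[f]qreprK -[g]qreprK -[h]qreprK.
rewrite -qclass_is_linear !qcompE -qclass_is_linear; congr qclass.
exact: pcomp_linearr.
Qed.

Lemma qcomp1m x y (f : quothom x y) : qcomp (qclass (pid y)) f = f.
Proof. by rewrite -[f]qreprK qcompE pcomp1m. Qed.

Lemma qcompm1 x y (f : quothom x y) : qcomp f (qclass (pid x)) = f.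
Proof. by rewrite -[f]qreprK qcompE pcompm1. Qed.

Lemma qcompA x y z t (h : quothom z t) (g : quothom y z) (f : quothom x y) :
  qcomp h (qcomp g f) = qcomp (qcomp h g) f.
Proof. by rewrite -[f]qreprK -[g]qreprK -[h]qreprK !qcompE pcompA. Qed.

Definition path_category_mod : lincat k :=
  @LinCat k (vert Q) quothom (fun x => qclass (pid x)) qcomp
    qcomp_linearl qcomp_linearr qcomp1m qcompm1 qcompA.

End PathCategory.

Section Nakajima.
Variables (k : fieldType) (Q : finquiver).
Local Notation ZQ := (repetition (framed Q)).

Definition frozen (x : vert ZQ) : bool := if x.1 is inr _ then true else false.

(* insub never fails on the arrows into x, by mesh_path. *)
Definition mesh_relator (x : vert ZQ) : pathcomb k (tau x) x :=
  \sum_(b <- arrows_into x)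
    oapp (fun p : qpath (tau x) x => << p >>) 0 (insub [:: sigma b; b]).

Inductive mesh_relation : forall x y : vert ZQ, pathcomb k x y -> Prop :=
  MeshRelation x of ~~ frozen x : mesh_relation (mesh_relator x).

Definition regular_nakajima : lincat k := path_category_mod mesh_relation.

(* (i, p) stands for the frozen vertex (i', p). *)
Definition frozen_vertex (u : fvert Q * int) : vert ZQ := (inr u.1, u.2).

Lemma frozenP (x : vert ZQ) : reflect (exists u, x = frozen_vertex u) (frozen x).
Proof.
apply: (iffP idP) => [|[u ->] //]; case: x => -[i|i] p // _.
by exists (i, p).
Qed.

Definition singular_nakajima : lincat k :=
  @full_subcat k regular_nakajima (fvert Q * int)%type frozen_vertex.

End Nakajima.

Definition dimvec (Q : finquiver) := {fsfun (fvert Q * int)%type -> nat with 0%N}.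

(* A C-module M, that is, a k-linear functor C^op -> Mod k, with M(u) = k^(d u)
   for all u.  Vectors are row vectors: for f : u1 -> u2, the map
   M(f) : k^(d u2) -> k^(d u1) is v |-> v *m act f. *)
Record matrix_module (k : fieldType) (C : lincat k) (d : C -> nat) :=
  MatrixModule {
    act : forall u1 u2 : C, {linear hom u1 u2 -> 'M[k]_(d u2, d u1)};
    act_id : forall u, act u u (idm u) = 1%:M;
    act_comp : forall u1 u2 u3 (g : hom u2 u3) (f : hom u1 u2),
      act u1 u3 (comp g f) = act u2 u3 g *m act u1 u2 f
  }.

(* Loaded only now, because it redefines names of monalg.  We write mpoly n k
   since {mpoly k[n]} would still be the notation of monalg. *)
From mathcomp Require Import mpoly.

(* Polynomials in finitely many of a possibly infinite family of variables. *)
Record polynomial_in (k : fieldType) (I : Type) := PolynomialIn {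
  nvars : nat;
  var : 'I_nvars -> I;
  poly_of : mpoly nvars k
}.

Arguments var {k I} p.

Definition peval (k : fieldType) (I : Type) (P : polynomial_in k I)
    (c : I -> k) : k :=
  (poly_of P).@[fun j => c (var P j)].

Definition zariski_closed (k : fieldType) (I : Type) (A : (I -> k) -> Prop) :
    Prop :=
  exists E : polynomial_in k I -> Prop,
    forall c, A c <-> (forall P, E P -> peval P c = 0).

(* The points of a Zariski closed subset of an affine space, with the
   functions on it given by the coordinates of that space.  Redundant
   coordinates are allowed. *)
Record affine_variety (k : fieldType) := AffineVariety {
  point :> Type;
  coord_index : Type;
  coord : coord_index -> point -> k;
  coord_inj : injective (fun x => coord^~ x);
  coord_closed : zariski_closed (fun c => exists x, c = coord^~ x)
}.

Definition regular_function (k : fieldType) (X : affine_variety k)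
    (f : X -> k) : Prop :=
  exists P : polynomial_in k (coord_index X),
    forall x, f x = peval P ((@coord k X)^~ x).

Definition morphism (k : fieldType) (X Y : affine_variety k) (f : X -> Y) :
    Prop :=
  forall i : coord_index Y, regular_function (fun x => coord i (f x)).

Definition isomorphic (k : fieldType) (X Y : affine_variety k) : Prop :=
  exists (f : X -> Y) (g : Y -> X),
    [/\ morphism f, morphism g, cancel f g & cancel g f].

Section AffineSpace.
Variables (k : fieldType) (n : nat).

Definition affine_coord (j : 'I_n) (v : 'rV[k]_n) : k := v 0 j.

Lemma affine_coord_inj : injective (fun v => affine_coord^~ v).
Proof. by move=> u v uv; apply/rowP => j; apply: (congr1 (@^~ j) uv). Qed.

Lemma affine_coord_closed :
  zariski_closed (fun c => exists v, c = affine_coord^~ v).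
Proof.
exists (fun _ => False) => c; split=> // _; exists (\row_j c j).
by apply: funext => j; rewrite /affine_coord mxE.
Qed.

Definition affine_space : affine_variety k :=
  AffineVariety affine_coord_inj affine_coord_closed.

End AffineSpace.

Lemma linear_ext (k : fieldType) (U V : lmodType k) (f g : {linear U -> V}) :
  f =1 g -> f = g.
Proof.
case: f g => [f [[f1] [f2]]] [g [[g1] [g2]]] /= /funext fg.
move: f1 f2 g1 g2; rewrite fg => f1 f2 g1 g2.
by rewrite (Prop_irrelevance f1 g1) (Prop_irrelevance f2 g2).
Qed.

Section ModuleVariety.
Variables (k : fieldType) (C : lincat k) (d : C -> nat).

Definition matrix_coord_index : Type :=
  {u : C * C & (hom u.1 u.2 * ('I_(d u.2) * 'I_(d u.1)))%type}.

Definition matrix_coord (i : matrix_coord_index) (M : matrix_module d) : k :=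
  act M (tag i).1 (tag i).2 (tagged i).1 (tagged i).2.1 (tagged i).2.2.

Local Notation crd u1 u2 f a b :=
  (@existT (C * C)%type
    (fun u => (hom u.1 u.2 * ('I_(d u.2) * 'I_(d u.1)))%type)
    (u1, u2) (f, (a, b))).

Lemma matrix_coord_inj : injective (fun M => matrix_coord^~ M).
Proof.
case=> [m m1 mM] [n n1 nM] mn.
have {}mn : m = n.
  apply: functional_extensionality_dep => u1.
  apply: functional_extensionality_dep => u2.
  apply: linear_ext => f; apply/matrixP => a b.
  exact: (congr1 (@^~ (crd u1 u2 f a b)) mn).
move: m1 mM n1 nM; rewrite mn => m1 mM n1 nM.
by rewrite (Prop_irrelevance m1 n1) (Prop_irrelevance mM nM).
Qed.

Lemma matrix_coord_closed :
  zariski_closed (fun c => exists M, c = matrix_coord^~ M).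
Proof.
exists (fun P => forall M, peval P (matrix_coord^~ M) = 0) => c; split.
  by case=> M -> P; apply.
move=> Pc.
pose A u1 u2 (f : hom u1 u2) : 'M[k]_(d u2, d u1) :=
  \matrix_(a, b) c (crd u1 u2 f a b).
have A_lin u1 u2 : linear (A u1 u2).
  move=> e f g; apply/matrixP => a b; rewrite !mxE.
  pose P := @PolynomialIn k matrix_coord_index 3
    (tnth [tuple crd u1 u2 (e *: f + g) a b; crd u1 u2 f a b; crd u1 u2 g a b])
    ('X_0 - (e *: 'X_1 + 'X_2%:R)).
  have evP c' : peval P c' = c' (crd u1 u2 (e *: f + g) a b)
      - (e * c' (crd u1 u2 f a b) + c' (crd u1 u2 g a b)).
    by rewrite /peval /= mevalB mevalD mevalZ !mevalXU.
  apply/eqP; rewrite -subr_eq0 -evP; apply/eqP; apply: Pc => M.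
  by rewrite evP /matrix_coord /= linearP !mxE subrr.
have A_id u : A u u (idm u) = 1%:M.
  apply/matrixP => a b; rewrite [LHS]mxE.
  pose P := @PolynomialIn k matrix_coord_index 1
    (fun=> crd u u (idm u) a b) ('X_0 - ((1%:M : 'M[k]_(d u)) a b)%:MP).
  have evP c' : peval P c' = c' (crd u u (idm u) a b) - (1%:M : 'M[k]_(d u)) a b.
    by rewrite /peval /= mevalB mevalC mevalXU.
  apply/eqP; rewrite -subr_eq0 -evP; apply/eqP; apply: Pc => M.
  by rewrite evP /matrix_coord /= act_id subrr.
have A_comp u1 u2 u3 (g : hom u2 u3) (f : hom u1 u2) :
    A u1 u3 (comp g f) = A u2 u3 g *m A u1 u2 f.
  apply/matrixP => a b; rewrite [LHS]mxE [RHS]mxE.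
  pose m := d u2.
  pose P := @PolynomialIn k matrix_coord_index (1 + (m + m))
    (fun j => match split j with
      | inl _ => crd u1 u3 (comp g f) a b
      | inr j => match split j with
        | inl i => crd u2 u3 g a i
        | inr i => crd u1 u2 f i b
        end
      end)
    ('X_(lshift _ 0) - \sum_(i < m)
        'X_(rshift 1 (lshift m i)) * 'X_(rshift 1 (rshift m i))).
  have evP c' : peval P c' = c' (crd u1 u3 (comp g f) a b)
      - \sum_(i < m) c' (crd u2 u3 g a i) * c' (crd u1 u2 f i b).
    rewrite /peval /= mevalB mevalXU (unsplitK (inl _)).
    congr (_ - _); rewrite raddf_sum; apply: eq_bigr => i _ /=.
    rewrite mevalM !mevalXU !(unsplitK (inr (_ : 'I_(m + m)))).
    by rewrite (unsplitK (inl _)) (unsplitK (inr (_ : 'I_m))).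
  under eq_bigr do rewrite !mxE.
  apply/eqP; rewrite -subr_eq0 -evP; apply/eqP; apply: Pc => M.
  by rewrite evP /matrix_coord /= act_comp !mxE subrr.
pose AL u1 u2 : {linear hom u1 u2 -> 'M[k]_(d u2, d u1)} :=
  HB.pack (A u1 u2) (GRing.isLinear.Build k (hom u1 u2) 'M[k]_(d u2, d u1)
    *:%R (A u1 u2) (A_lin u1 u2)).
exists (@MatrixModule k C d AL A_id A_comp).
by apply: funext => -[[u1 u2] [f [a b]]]; rewrite /matrix_coord /= mxE.
Qed.

(* Evaluation at the morphisms u1 -> u2 followed by the matrix entries spans
   the linear forms on Hom_k(Hom(u1, u2), k^(d u2 x d u1)) when Hom(u1, u2) is
   finite-dimensional, so these coordinates generate the same functions as
   those of the product of these spaces. *)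
Definition module_variety : affine_variety k :=
  AffineVariety matrix_coord_inj matrix_coord_closed.

End ModuleVariety.

Definition quiver_variety (k : fieldType) (Q : finquiver) (w : dimvec Q) :
    affine_variety k :=
  @module_variety k (singular_nakajima k Q) (fun u => w u).

(* Main.v *)
Require Import Defs.
From HB Require Import structures.
From mathcomp Require Import all_boot all_order all_algebra.
From mathcomp Require Import finmap monalg boolp zify.
From mathcomp Require Import complex reals.
Import Defs.

Set Implicit Arguments.
Unset Strict Implicit.
Unset Printing Implicit Defensive.

Import Order.TTheory GRing.Theory Num.Theory.

(** Why the quiver variety is an affine space.  By the mesh relation at a non
    frozen vertex of the form [up v], passing through the frozen vertex v is
    the same, up to sign, as inserting the sum of the two-step paths from v to
    [up v] through non frozen vertices.  A module over the singular Nakajima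
    category is therefore the same thing as a mesh system: a family of matrices
    indexed by the paths g of the repetition quiver of Q, such that the sum of
    the values on the paths obtained by inserting a mesh between two paths is
    minus the product of the values on these two ([family_of],
    [module_of], [module_eq], [family_of_module_of]).

    If the singular Nakajima category is free, a mesh system can be prescribed
    arbitrarily on a basis of the mesh category of the repetition quiver, and
    is then determined.  Such a basis is formed by normal words, built length by
    length: the pairs (normal word of length n+1, arrow) are cut down by the
    mesh relations, one for each normal word of length n, and as many pairs as
    there are relations are discarded ([next]).  Rewriting a discarded pair by
    the remaining ones turns values on normal words into a mesh system
    ([extension_mesh], [extension_nword], [mesh_system_unique]).  The values
    are polynomials in the prescribed ones.  As Q is acyclic, only finitely
    many normal words join two given vertices, so the entries of the prescribed
    matrices are finitely many free coordinates ([quiver_variety_affine]).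

    What is needed for this is that the mesh relations are independent: in
    the mesh category, no nonzero morphism is killed by all arrows.  For a
    Dynkin quiver this fails.  If Q is connected and not Dynkin, there is a
    positive vector d with 2 d_i at most the sum of d over the neighbours of i.
    Then, going from one length to the next, the d-weighted dimension of a
    nonzero family of subspaces stable under the arrows strictly increases
    ([growing], [next_growing]), by rank-nullity for the mesh maps and
    induction on the length; a morphism killed by all arrows would span a
    counterexample.

    The vector d comes from the classification of diagrams
    ([exists_weights]).  A graph without such a vector has no cycle, no two
    branchings and no branching with long arms, since a cycle or an extended
    Dynkin tree carries a vector, which spreads to the whole connected graph.
    So it is a tree with at most three arms, of lengths that leave only
    A, D and E. *)

(** * Weights on a graph that is not a Dynkin diagram *)

(** Counts multiplicities in concatenations of the same pieces; truth values are
    generalized to numbers, to avoid case splits. *)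
Ltac perm_count :=
  apply/permP => ?; rewrite ?(count_cat, count_rev) /= ?(count_cat, count_rev) /=;
  rewrite ?(count_cat, count_rev) /=;
  repeat match goal with |- context [nat_of_bool ?b] => move: (nat_of_bool b) => ? end;
  lia.

Section Multigraph.
Variables (V : finType) (m : V -> V -> nat).
Hypothesis m_sym : forall x y, m x y = m y x.
Hypothesis m_irr : forall x, m x x = 0.
Implicit Types (x y v c : V) (d : V -> nat) (S : {set V}).

Definition edge x y : bool := 0 < m x y.

(** The Cartan matrix of the graph takes d to a vector with no positive entry.
    Radical vectors of extended Dynkin diagrams, extended by zero, are
    examples. *)
Definition superadditive d : Prop := forall x, 2 * d x <= \sum_y m x y * d y.

Definition infinite_type : Prop := exists2 d, superadditive d & exists x, 0 < d x.

Lemma edge_sym : symmetric edge.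
Proof. by move=> x y; rewrite /edge m_sym. Qed.

Lemma sum_neighbours d x (s : seq V) : uniq s -> all (edge x) s ->
  \sum_(y <- s) d y <= \sum_y m x y * d y.
Proof.
move=> us /allP xs; rewrite big_uniq //= [X in _ <= X](bigID (mem s)) /=.
apply: leq_trans (leq_addr _ _); apply: leq_sum => y ys.
by rewrite leq_pmull //; apply: xs.
Qed.

Lemma boundary (P : pred V) x y : connect edge x y -> P x -> ~~ P y ->
  exists x' y', [/\ P x', ~~ P y' & edge x' y'].
Proof.
case/connectP => p; elim: p x => [|z p IHp] x /=; first by move=> _ -> ->.
case/andP=> xz pz Dy Px nPy; have [Pz|nPz] := boolP (P z); last by exists x, z.
exact: IHp pz Dy Pz nPy.
Qed.

(** A vertex y adjacent to the support joins the support if d is replaced by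
    twice d plus the indicator of y: at y the neighbour in the support now
    weighs at least 2, and elsewhere the sums only increase. *)
Lemma superadditive_pos d : (forall x y, connect edge x y) -> superadditive d ->
  (exists x, 0 < d x) -> exists2 d', superadditive d' & forall x, 0 < d' x.
Proof.
move=> conn; have [n] := ubnP #|[set x | d x == 0]|.
elim: n d => // n IHn d zn sd [x0 dx0].
have [d_pos|/existsP[y0 dy0]] := boolP [forall x, 0 < d x].
  by exists d => // x; apply/forallP: x.
move: dy0; rewrite -eqn0Ngt => /eqP dy0.
have := boundary (P := fun x => 0 < d x) (conn x0 y0) dx0.
rewrite dy0 => /(_ isT)[x [y [dx + xy]]]; rewrite -eqn0Ngt => /eqP dy.
apply: (IHn (fun z => 2 * d z + (z == y))); last by exists x; lia.
  rewrite -ltnS; apply: leq_trans zn; rewrite ltnS; apply/proper_card/properP.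
  split; first by apply/subsetP => z; rewrite !inE; lia.
  by exists y; rewrite !inE ?dy // eqxx addn_eq0 andbF.
move=> z; have [->|zy] := eqVneq z y.
  rewrite dy; apply: leq_trans (sum_neighbours _ (s := [:: x]) _ _) => //=.
    by rewrite big_seq1; case: eqP => [Dx|]; [rewrite Dx dy in dx | lia].
  by rewrite edge_sym xy.
rewrite addn0 (leq_trans (leq_mul (leqnn 2) (leq_mul (leqnn 2) (leqnn (d z))))) //.
apply: (@leq_trans (\sum_y0 m z y0 * (2 * d y0))).
  under eq_bigr do rewrite mulnCA.
  by rewrite -big_distrr leq_mul2l sd orbT.
by apply: leq_sum => u _; rewrite leq_mul2l leq_addr orbT.
Qed.

(** The indicator of S is superadditive.  This applies to multiple edges and to
    cycles. *)
Lemma min_degree2 S x0 : x0 \in S -> (forall x, x \in S -> 2 <= \sum_(y in S) m x y) ->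
  infinite_type.
Proof.
move=> x0S deg; exists (fun x => (x \in S) : nat); last by exists x0; rewrite x0S.
move=> x; case: (boolP (x \in S)) => [xS|]; last by [].
rewrite muln1 (leq_trans (deg x xS)) // big_mkcond /=; apply: leq_sum => y _.
by case: (y \in S); rewrite ?muln1.
Qed.

Definition degree_sum S := \sum_(x in S) \sum_(y in S) m x y.

Lemma degree_sumU1 S v : v \notin S ->
  degree_sum (v |: S) = degree_sum S + 2 * \sum_(y in S) m v y.
Proof.
move=> vS; rewrite /degree_sum big_setU1 //= big_setU1 //= m_irr add0n.
under [X in _ + X]eq_bigr do rewrite big_setU1 //= m_sym.
by rewrite big_split /=; lia.
Qed.

(** Weights are given by a list of weighted vertices W, so that the sum over the
    neighbours of x splits along any splitting of W. *)
Definition weighted_sum (W : seq (V * nat)) x : nat :=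
  \sum_(p <- W) p.2 * m x p.1.

Lemma weighted_infinite (W : seq (V * nat)) : uniq (unzip1 W) ->
  (exists2 p, p \in W & 0 < p.2) ->
  (forall p, p \in W -> 2 * p.2 <= weighted_sum W p.1) -> infinite_type.
Proof.
move=> uW [p0 p0W p0_gt0] Wsup; pose d y := \sum_(p <- W | p.1 == y) p.2.
have dW p : p \in W -> d p.1 = p.2.
  rewrite /d; elim: (W) uW => //= q W' IHW /andP[qW uW'].
  rewrite inE big_cons => /predU1P[->|pW].
    rewrite eqxx big_seq_cond big1 ?addn0 // => r /andP[rW /eqP rq].
    by case/mapP: qW; exists r.
  rewrite IHW //; case: eqP => // qp; case/mapP: qW; by exists p.
have sumE x : \sum_y m x y * d y = weighted_sum W x.
  under eq_bigr do rewrite big_distrr /=.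
  rewrite (exchange_big_dep predT) //=; apply: eq_bigr => p _.
  by rewrite (big_pred1 p.1) 1?mulnC // => y; rewrite eq_sym.
exists d; last by exists p0.1; rewrite dW.
move=> x; rewrite sumE; have [/mapP[p pW ->]|xW] := boolP (x \in unzip1 W).
  by rewrite dW ?Wsup.
rewrite /d big_seq_cond big1 // => p /andP[pW /eqP px].
by case/mapP: xW; exists p.
Qed.

Lemma weighted_sum_ge W x p : p \in W -> edge x p.1 -> p.2 <= weighted_sum W x.
Proof.
move=> pW xp; rewrite /weighted_sum (big_rem p) //=.
by rewrite (leq_trans (leq_pmulr _ xp)) // leq_addr.
Qed.

Lemma weighted_sum_cat W W' x :
  weighted_sum (W ++ W') x = weighted_sum W x + weighted_sum W' x.
Proof. exact: big_cat. Qed.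

Lemma weighted_sum_cons p W x :
  weighted_sum (p :: W) x = p.2 * m x p.1 + weighted_sum W x.
Proof. exact: big_cons. Qed.

(** Extended Dynkin type D: weight 2 on a chain and weight 1 on two tips at each
    of its ends.  The chain may be a single vertex, with four tips. *)
Lemma two_forks q0 q x1 x2 y1 y2 : uniq [:: x1, x2, y1, y2, q0 & q] ->
  path edge q0 q -> edge q0 x1 -> edge q0 x2 ->
  edge (last q0 q) y1 -> edge (last q0 q) y2 -> infinite_type.
Proof.
move=> un pq e1 e2 f1 f2.
pose chain := [seq (z, 2) | z <- q0 :: q].
apply: (@weighted_infinite ([:: (x1, 1); (x2, 1); (y1, 1); (y2, 1)] ++ chain)).
- by rewrite /unzip1 map_cat -map_comp map_id.
- by exists (x1, 1); rewrite // inE eqxx.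
have tip y z : z \in q0 :: q -> edge z y -> 2 <= weighted_sum chain y.
  move=> zq zy; apply: (@weighted_sum_ge _ _ (z, 2)); last by rewrite edge_sym.
  by apply/mapP; exists z.
have hq : q0 \in q0 :: q by apply: mem_head.
have lq := mem_last q0 q.
move=> p; rewrite mem_cat weighted_sum_cat.
case/orP=> [|/mapP[z zq ->]] /=.
  rewrite !inE => /or4P[]/eqP->; apply: leq_trans (leq_addl _ _).
  - exact: tip e1.
  - exact: tip e2.
  - exact: tip f1.
  - exact: tip f2.
have [p1 [p2 Dq]] : exists p1 p2, q0 :: q = p1 ++ z :: p2.
  by case/splitPr: zq => p1 p2; exists p1, p2.
rewrite /chain Dq map_cat /= !weighted_sum_cons weighted_sum_cat weighted_sum_cons.
rewrite m_irr /= !mul1n /weighted_sum big_nil -/(weighted_sum _ z) -/(weighted_sum _ z).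
have left2 : 2 <= m z x1 + m z x2 + weighted_sum [seq (z, 2) | z <- p1] z.
  case/lastP: p1 Dq => [[<- _]|p1 a Dq].
    by move: e1 e2; rewrite /edge; lia.
  apply: leq_trans (leq_addl _ _); apply: (@weighted_sum_ge _ _ (a, 2)).
    by apply/mapP; exists a; rewrite // mem_rcons mem_head.
  rewrite /= edge_sym; have : sorted edge (q0 :: q) by [].
  by rewrite Dq cat_rcons => /cat_sorted2[_ /= /andP[]].
have right2 : 2 <= m z y1 + m z y2 + weighted_sum [seq (z, 2) | z <- p2] z.
  case: p2 Dq => [Dq|a p2 Dq].
    have lz : last q0 q = z by rewrite -[LHS]/(last q0 (q0 :: q)) Dq cats1 last_rcons.
    by move: f1 f2; rewrite lz /edge; lia.
  apply: leq_trans (leq_addl _ _); apply: (@weighted_sum_ge _ _ (a, 2)).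
    by apply/mapP; exists a; rewrite // mem_head.
  have : sorted edge (q0 :: q) by [].
  by rewrite Dq => /cat_sorted2[_ /= /andP[]].
rewrite muln0 !add0n addn0; apply: leq_trans (leq_add left2 right2) _.
by rewrite addnACA -!addnA.
Qed.

(** Weights that decrease by delta at each step of the arm A, away from a centre
    of weight t. *)
Fixpoint arm_weights (t delta : nat) (A : seq V) : seq (V * nat) :=
  if A is a :: A' then (a, t - delta) :: arm_weights (t - delta) delta A' else [::].

Lemma unzip1_arm t delta A : unzip1 (arm_weights t delta A) = A.
Proof. by elim: A t => //= a A IHA t; rewrite IHA. Qed.

(** The weights along the arm are an arithmetic progression that would reach 0
    one step beyond its end, so twice a weight is the sum of its neighbours. *)
Lemma arm_super delta A c t p : t = (size A).+1 * delta -> path edge c A ->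
  p \in arm_weights t delta A ->
  2 * p.2 <= t * m p.1 c + weighted_sum (arm_weights t delta A) p.1.
Proof.
elim: A c t => //= a A IHA c t Dt /andP[ca pA].
have Dt' : t - delta = (size A).+1 * delta by rewrite Dt mulSn addKn.
rewrite inE weighted_sum_cons /= => /predU1P[->|pW]; last first.
  by apply: leq_trans (leq_addl _ _); apply: IHA pA pW.
rewrite /= m_irr muln0 add0n; apply: leq_trans (leq_add (leq_pmulr t _) (leqnn _)).
  case: A pA Dt Dt' {IHA} => [_|b A /andP[ab _]] /= Dt Dt'.
    by rewrite mul1n in Dt'; rewrite /weighted_sum big_nil; lia.
  rewrite weighted_sum_cons /=.
  have := leq_pmulr (t - delta - delta) ab; move: Dt'; rewrite mulSn Dt; lia.
by rewrite -/(edge a c) edge_sym.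
Qed.

Lemma arm_first delta A c t : t = (size A).+1 * delta -> path edge c A ->
  t - delta <= weighted_sum (arm_weights t delta A) c.
Proof.
case: A => [->|a A _ /andP[ca _]]; first by rewrite mul1n subnn.
by apply: (@weighted_sum_ge _ _ (a, t - delta)); rewrite ?mem_head.
Qed.

(** A centre with three arms, possibly empty.  All of A, D and E are of this
    form, as are the extended diagrams of type E. *)
Definition tripod c (A1 A2 A3 : seq V) : Prop :=
  uniq (c :: A1 ++ A2 ++ A3) /\ [/\ path edge c A1, path edge c A2 & path edge c A3].

(** At the centre the three arms contribute 3 M - (k1 + k2 + k3).  The extended
    diagrams of type E6, E7 and E8 arise for (M; k1, k2, k3) equal to
    (3; 1, 1, 1), (4; 1, 1, 2) and (6; 1, 2, 3). *)
Lemma long_arms c A1 A2 A3 M k1 k2 k3 : tripod c A1 A2 A3 -> 0 < M ->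
  M = (size A1).+1 * k1 -> M = (size A2).+1 * k2 -> M = (size A3).+1 * k3 ->
  k1 + k2 + k3 <= M -> infinite_type.
Proof.
case=> un [p1 p2 p3] M0 D1 D2 D3 dM.
apply: (@weighted_infinite ((c, M) ::
  arm_weights M k1 A1 ++ arm_weights M k2 A2 ++ arm_weights M k3 A3)).
- by rewrite /unzip1 /= !map_cat -!/(unzip1 _) !unzip1_arm.
- by exists (c, M); rewrite // mem_head.
move=> p; rewrite inE !mem_cat weighted_sum_cons !weighted_sum_cat /=.
have f1 := arm_first D1 p1; have f2 := arm_first D2 p2; have f3 := arm_first D3 p3.
case/predU1P=> [->|/or3P[] pA] /=.
- rewrite m_irr muln0 add0n; apply: leq_trans (leq_add f1 (leq_add f2 f3)).
  by clear f1 f2 f3; lia.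
- by apply: leq_trans (arm_super D1 p1 pA) _; rewrite leq_add2l leq_addr.
- apply: leq_trans (arm_super D2 p2 pA) _; rewrite leq_add2l.
  by apply: leq_trans (leq_addl _ _); apply: leq_addr.
- apply: leq_trans (arm_super D3 p3 pA) _; rewrite leq_add2l.
  by apply: leq_trans (leq_addl _ _); apply: leq_addl.
Qed.

Hypothesis finite_type : ~ infinite_type.

Lemma mult_le1 x y : m x y <= 1.
Proof.
rewrite leqNgt; apply/negP => xy; apply: finite_type.
have xNy : x != y by apply: contraL xy => /eqP->; rewrite m_irr.
apply: (@min_degree2 [set x; y] x); first by rewrite !inE eqxx.
by move=> z; rewrite !inE big_setU1 ?inE //= big_set1 => /orP[]/eqP->;
  rewrite ?m_irr // m_sym addn0.
Qed.

(** Otherwise some subset of S has minimal degree 2; so a leaf can be removed. *)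
Lemma forest S : S != set0 -> degree_sum S + 2 <= 2 * #|S|.
Proof.
have [n] := ubnP #|S|; elim: n S => // n IHn S Sn S0.
have [x xS degx] : exists2 x, x \in S & \sum_(y in S) m x y <= 1.
  apply: contra_notP finite_type => noleaf; have /set0Pn[x0 x0S] := S0.
  apply: (min_degree2 x0S) => x xS; rewrite ltnNge; apply/negP => ?.
  by apply: noleaf; exists x.
rewrite -(setD1K xS) degree_sumU1 ?setD11 // cardsU1 setD11 /=.
have degx' : \sum_(y in S :\ x) m x y <= 1.
  by move: degx; rewrite (big_setD1 x) //= m_irr.
have [->|S'0] := eqVneq (S :\ x) set0.
  by rewrite /degree_sum !big_set0 cards0.
have := IHn _ _ S'0; rewrite (cardsD1 x) xS in Sn.
by move=> /(_ Sn); lia.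
Qed.

Definition tree_list x0 (l : seq V) (par : nat -> nat) : Prop :=
  uniq l /\ forall b, 0 < b < size l ->
    par b < b /\ edge (nth x0 l b) (nth x0 l (par b)).

(** The edges to the parents already attain the bound on the number of edges
    given by [forest], so there is no other edge. *)
Lemma tree_listP x0 l par : tree_list x0 l par -> forall a b,
  a < b < size l -> m (nth x0 l b) (nth x0 l a) = (a == par b).
Proof.
case=> ul lpar.
have inS b y : b <= size l -> (y \in [set z in take b l]) -> exists2 a, a < b & y = nth x0 l a.
  move=> bl; rewrite inE => /(nthP x0)[a]; rewrite size_takel // => ab <-.
  by exists a; rewrite ?nth_take.
have mem a b : a < b -> b <= size l -> nth x0 l a \in [set z in take b l].
  by move=> ab bl; rewrite inE -(nth_take x0 ab) mem_nth // size_takel.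
have newS b : b < size l -> nth x0 l b \notin [set z in take b l].
  move=> bl; apply/negP => /(inS _ _ (ltnW bl))[a ab /eqP].
  by rewrite nth_uniq ?(ltn_trans ab) // eq_sym ltn_eqF.
have addS b : b < size l ->
    [set z in take b.+1 l] = nth x0 l b |: [set z in take b l].
  move=> bl; apply/setP => z; rewrite (take_nth x0) // !inE mem_rcons inE.
  done.
have cardS b : b <= size l -> #|[set z in take b l]| = b.
  by move=> bl; rewrite cardsE (card_uniqP _) ?take_uniq // size_takel.
have deg_ge b : 0 < b < size l -> 1 <= \sum_(y in [set z in take b l]) m (nth x0 l b) y.
  move=> bl; have [pb eb] := lpar b bl; case/andP: bl => b0 bl.
  by rewrite (bigD1 (nth x0 l (par b))) ?mem ?(ltnW bl) //=; move: eb; rewrite /edge; lia.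
have sumS b : b < size l -> 2 * b <= degree_sum [set z in take b.+1 l].
  elim: b => // b IHb bl; rewrite addS // degree_sumU1 ?newS //.
  by have := IHb (ltnW bl); have := deg_ge b.+1 bl; lia.
have degE b : 0 < b < size l -> \sum_(y in [set z in take b l]) m (nth x0 l b) y = 1.
  case: b => // b bl; apply/eqP; rewrite eqn_leq deg_ge // andbT.
  have : [set z in take b.+2 l] != set0.
    by apply/set0Pn; exists (nth x0 l 0); apply: mem.
  move/forest; rewrite cardS // addS // degree_sumU1 ?newS //.
  by have := sumS b (ltnW bl); lia.
move=> a b /andP[ab bl]; have b0 : 0 < b < size l by rewrite bl (leq_ltn_trans _ ab).
have [pb eb] := lpar b b0; have := degE b b0.
rewrite (bigD1 (nth x0 l (par b))) ?mem ?(ltnW bl) //=.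
have [->|apb] := eqVneq a (par b).
  by move: eb (mult_le1 (nth x0 l b) (nth x0 l (par b))); rewrite /edge; lia.
rewrite (bigD1 (nth x0 l a)) ?mem ?(ltnW bl) //=; last first.
  by rewrite nth_uniq ?(ltn_trans _ bl).
by move: eb; rewrite /edge; lia.
Qed.

Lemma tripod_swap c A1 A2 A3 : tripod c A1 A2 A3 -> tripod c A2 A1 A3.
Proof.
case=> un [p1 p2 p3]; split=> //; rewrite -(perm_uniq (s1 := c :: A1 ++ A2 ++ A3)) //.
by rewrite perm_cons perm_catCA.
Qed.

Lemma tripod_rot c A1 A2 A3 : tripod c A1 A2 A3 -> tripod c A2 A3 A1.
Proof.
case=> un [p1 p2 p3]; split=> //; rewrite -(perm_uniq (s1 := c :: A1 ++ A2 ++ A3)) //.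
by rewrite perm_cons catA perm_sym catA perm_catC catA.
Qed.

Definition bigger_tripod n : Prop := exists c B1 B2 B3,
  tripod c B1 B2 B3 /\ size (B1 ++ B2 ++ B3) = n.+1.

Lemma path_edge_rev c p x : path edge c (rcons p x) -> path edge x (rcons (rev p) c).
Proof.
have := rev_path edge c (rcons p x); rewrite last_rcons belast_rcons rev_cons => ->.
by rewrite (eq_path edge_sym).
Qed.

(** If one arm is empty the other two form a chain, and any vertex of the chain
    can serve as the centre; the new vertex v becomes the third arm. *)
Lemma recentre c p1 x p2 A3 v : tripod c (p1 ++ x :: p2) [::] A3 ->
  v \notin c :: (p1 ++ x :: p2) ++ A3 -> edge x v ->
  bigger_tripod (size ((p1 ++ x :: p2) ++ A3)).
Proof.
case=> un [pa _ p3] vN xv; exists x, (rev p1 ++ c :: A3), p2, [:: v]; split; last first.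
  by rewrite ?(size_cat, size_rev, size_rcons) /= ?(size_cat, size_rev, size_rcons) /=; lia.
move: pa; rewrite -cat_rcons path.cat_path last_rcons => /andP[pa pb].
split; last first.
  split; rewrite //= ?xv // -cat_rcons path.cat_path last_rcons p3 andbT.
  exact: path_edge_rev.
rewrite (perm_uniq (s2 := v :: c :: (p1 ++ x :: p2) ++ A3)).
  by rewrite cons_uniq vN.
by perm_count.
Qed.

(** If x is the end of the arm, the arm gets longer; if another arm is empty, x
    becomes the centre; otherwise x and c are two branchings. *)
Lemma grow_arm c A1 A2 A3 v x : tripod c A1 A2 A3 ->
  v \notin c :: A1 ++ A2 ++ A3 -> x \in A1 -> edge x v ->
  bigger_tripod (size (A1 ++ A2 ++ A3)).
Proof.
move=> tri vN xA xv; case/splitPr: xA tri vN => p1 [|z p2] tri vN.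
  case: tri => un [pa pb pc]; exists c, (rcons (p1 ++ [:: x]) v), A2, A3; split.
    split; last by split; rewrite // rcons_path pa last_cat.
    rewrite (perm_uniq (s2 := v :: c :: (p1 ++ [:: x]) ++ A2 ++ A3)).
      by rewrite cons_uniq vN.
    by rewrite -cats1; perm_count.
  by rewrite ?(size_cat, size_rev, size_rcons) /= ?(size_cat, size_rev, size_rcons) /=; lia.
case: A2 A3 tri vN => [|a A2] A3 tri vN; first exact: (recentre tri vN xv).
case: A3 tri vN => [|b A3] tri vN.
  rewrite cats0 -[X in _ ++ X]cats0.
  have := recentre (tripod_swap (tripod_rot (tripod_rot tri))) _ xv.
  by rewrite cats0; apply; rewrite cats0 in vN.
exfalso; apply: finite_type; case: tri => un [pa pb pc].
move: pa; rewrite -cat_rcons path.cat_path last_rcons => /and3P[pa xz _].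
apply: (@two_forks c (rcons p1 x) a b z v); rewrite ?last_rcons //.
- have: uniq (v :: c :: (p1 ++ [:: x, z & p2]) ++ (a :: A2) ++ b :: A3).
    by rewrite cons_uniq vN.
  rewrite (perm_uniq (s2 := [:: a, b, z, v, c & rcons p1 x] ++ p2 ++ A2 ++ A3)).
    by rewrite cat_uniq => /andP[].
  by rewrite -cats1; perm_count.
- by case/andP: pb.
- by case/andP: pc.
Qed.

(** Either an empty arm takes v, or c has four neighbours. *)
Lemma grow_centre c A1 A2 A3 v : tripod c A1 A2 A3 ->
  v \notin c :: A1 ++ A2 ++ A3 -> edge c v ->
  bigger_tripod (size (A1 ++ A2 ++ A3)).
Proof.
move=> tri vN cv.
have add B2 B3 : tripod c [::] B2 B3 -> v \notin c :: B2 ++ B3 ->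
    bigger_tripod (size (B2 ++ B3)).
  case=> un [_ p2 p3] vB; exists c, [:: v], B2, B3; split=> //.
  split; last by rewrite /= cv.
  rewrite (perm_uniq (s2 := v :: c :: B2 ++ B3)); first by rewrite cons_uniq vB.
  by perm_count.
case: A1 tri vN => [|a1 A1] tri vN; first exact: add tri vN.
case: A2 tri vN => [|a2 A2] tri vN.
  by apply: (add _ _ (tripod_swap tri)); move: vN.
case: A3 tri vN => [|a3 A3] tri vN.
  rewrite cats0; rewrite cats0 in vN.
  exact: (add _ _ (tripod_rot (tripod_rot tri)) vN).
exfalso; apply: finite_type; case: tri => un [/andP[ca1 _] /andP[ca2 _] /andP[ca3 _]].
apply: (@two_forks c [::] a1 a2 a3 v) => //.
have: uniq (v :: c :: (a1 :: A1) ++ (a2 :: A2) ++ a3 :: A3) by rewrite cons_uniq vN.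
rewrite (perm_uniq (s2 := [:: a1; a2; a3; v; c] ++ A1 ++ A2 ++ A3)).
  by rewrite cat_uniq => /andP[].
by perm_count.
Qed.

Lemma spanning_tripod (x0 : V) : (forall x y, connect edge x y) ->
  exists c A1 A2 A3, tripod c A1 A2 A3 /\ forall x, x \in c :: A1 ++ A2 ++ A3.
Proof.
move=> conn; pose spans c A1 A2 A3 := [forall x, x \in c :: A1 ++ A2 ++ A3].
have [c [A1 [A2 [A3 [tri sizeA]]]]] : exists c A1 A2 A3, tripod c A1 A2 A3 /\
    (spans c A1 A2 A3 \/ size (A1 ++ A2 ++ A3) = #|V|).
  elim: #|V| => [|n [c [A1 [A2 [A3 [tri [sp|sizeA]]]]]]].
  - by exists x0, [::], [::], [::]; split; [| right].
  - by exists c, A1, A2, A3; split; [| left].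
  have [sp|/existsP[y yN]] := boolP (spans c A1 A2 A3).
    by exists c, A1, A2, A3; split; [| left].
  have cT : c \in c :: A1 ++ A2 ++ A3 by apply: mem_head.
  have [x [v [xT vN xv]]] := boundary (P := mem (c :: A1 ++ A2 ++ A3)) (conn c y) cT yN.
  suff [c' [B1 [B2 [B3 [tri' sizeB]]]]] : bigger_tripod (size (A1 ++ A2 ++ A3)).
    by exists c', B1, B2, B3; split; [| right; rewrite sizeB sizeA].
  have pE (B1 B2 B3 : seq V) : size (B1 ++ B2 ++ B3) = size B1 + size B2 + size B3.
    by rewrite !size_cat addnA.
  move: xT xv; rewrite /= inE !mem_cat => /predU1P[->|/or3P[]xA] xv.
  - exact: grow_centre tri vN xv.
  - exact: grow_arm tri vN xA xv.
  - have tri' := tripod_rot tri; have := grow_arm tri' _ xA xv.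
    rewrite !pE [X in bigger_tripod X]addnC addnA; apply.
    by move: vN; rewrite !(inE, mem_cat) !negb_or => /and4P[-> -> -> ->].
  - have tri' := tripod_rot (tripod_rot tri); have := grow_arm tri' _ xA xv.
    rewrite !pE -[X in bigger_tripod X]addnA [X in bigger_tripod X]addnC; apply.
    by move: vN; rewrite !(inE, mem_cat) !negb_or => /and4P[-> -> -> ->].
exists c, A1, A2, A3; split=> //; case: sizeA => [/forallP //|sizeA].
have [un _] := tri; have := uniq_leq_size un (s2 := enum V).
by move=> /(_ (fun x _ => mem_enum V x)); rewrite -cardE /= sizeA ltnn.
Qed.

Definition is_ade : Prop := exists T (x0 : V) (l : seq V),
  [/\ uniq l, size l = ade_rank T, forall x, x \in l &
   forall a b, a < ade_rank T -> b < ade_rank T ->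
     m (nth x0 l a) (nth x0 l b) = ade_adj T a b].

(** The arm A read towards the centre, followed by the centre and the arm B,
    is the chain of the diagram; C is the additional vertex, if any. *)
Lemma ade_of_tripod T c A B C : tripod c A B C -> size C <= 1 ->
  (forall x, x \in c :: A ++ B ++ C) -> (size A + size B + size C).+1 = ade_rank T ->
  (forall a b, b < ade_rank T -> ade_edge T a b =
     (a < b) && (a == if b == size A + (size B).+1 then size A else b.-1)) ->
  is_ade.
Proof.
case=> un [pA pB pC] C1 span rankT adjT.
pose t := rev (c :: A) ++ B; pose l := t ++ C.
have ul : uniq l.
  rewrite (perm_uniq (s2 := c :: A ++ B ++ C)) //; rewrite /l /t.
  by perm_count.
have sl : size l = ade_rank T.
  by rewrite /l /t !(size_cat, size_rev) /= -rankT; lia.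
have st : size t = size A + (size B).+1 by rewrite /t size_cat size_rev /=; lia.
have tsort : sorted edge t.
  have -> : t = last c A :: rev (belast c A) ++ B.
    by rewrite /t lastI rev_rcons.
  have flip : path (fun z => edge^~ z) c A = path edge c A.
    by apply: eq_path => x y; apply: edge_sym.
  rewrite /sorted path.cat_path rev_path flip pA /=.
  have -> : last (last c A) (rev (belast c A)) = c.
    by case: (A) => [|a A'] //=; rewrite rev_cons last_rcons.
  exact: pB.
pose par b := if b == size A + (size B).+1 then size A else b.-1.
have tl : tree_list c l par.
  split=> // b /andP[b0]; rewrite size_cat st /par => bl.
  case: eqP => [Db|/eqP bt].
    split; first by lia.
    have -> : nth c l b = nth c C 0 by rewrite nth_cat st Db ltnn subnn.
    have -> : nth c l (size A) = c.
      have -> : nth c l (size A) = nth c t (size A).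
        by rewrite nth_cat st ifT //; lia.
      by rewrite nth_cat size_rev ltnSn nth_rev //= subSS subnn.
    by move: pC bl; rewrite Db; case: (C) => [|z C'] /=; [lia | rewrite edge_sym => /andP[]].
  have bt' : b < size t by rewrite st; move: bt bl C1; lia.
  have nE i : i < size t -> nth c l i = nth c t i by move=> it; rewrite nth_cat it.
  split; first by lia.
  case: b b0 bt' {bl bt} => // b _ bt' /=; rewrite !nE ?(ltnW bt') //.
  by rewrite edge_sym; have /(sortedP c) := tsort; apply.
exists T, c, l; split=> //.
  move=> x; rewrite (perm_mem (s2 := c :: A ++ B ++ C)) //; rewrite /l /t.
  by perm_count.
have mE a b : a < b -> b < ade_rank T ->
    m (nth c l b) (nth c l a) = ade_adj T a b.
  move=> ab bT; rewrite (tree_listP tl) ?ab ?sl // /ade_adj adjT // ab /=.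
  by rewrite adjT ?(ltn_trans ab) // ltnNge (ltnW ab) orbF.
move=> a b aT bT; have [ab|ba|->] := ltngtP a b.
- by rewrite m_sym mE.
- by rewrite mE // /ade_adj orbC.
- by rewrite m_irr /ade_adj !adjT // ltnn.
Qed.

(** With the arms sorted by length, the shape (p, q, r) is of type A if r = 0, D
    if q = r = 1, E if (q, r) = (2, 1) and p is at most 4; in the other cases
    shorter arms give an extended diagram of type E. *)
Lemma ade_of_spanning c A1 A2 A3 : tripod c A1 A2 A3 ->
  (forall x, x \in c :: A1 ++ A2 ++ A3) -> is_ade.
Proof.
wlog s21 : A1 A2 A3 / size A2 <= size A1.
  move=> IH tri span; case: (leqP (size A2) (size A1)) => s12; first exact: IH tri span.
  apply: (IH A2 A1 A3 (ltnW s12) (tripod_swap tri)) => x.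
  by have := span x; rewrite !(inE, mem_cat); case: (x \in A1) => //=; rewrite ?orbT.
wlog s31 : A1 A2 A3 s21 / size A3 <= size A1.
  move=> IH tri span; case: (leqP (size A3) (size A1)) => s13.
    exact: (IH _ _ _ s21 s13 tri span).
  apply: (IH A3 A1 A2 (ltnW s13) (leq_trans s21 (ltnW s13)) (tripod_rot (tripod_rot tri))) => x.
  have := span x; rewrite !(inE, mem_cat); case: (x \in A3) => //=; rewrite ?orbT ?orbF //.
wlog s32 : A1 A2 A3 s21 s31 / size A3 <= size A2.
  move=> IH tri span; case: (leqP (size A3) (size A2)) => s23.
    exact: (IH _ _ _ s21 s31 s23 tri span).
  apply: (IH A1 A3 A2 s31 s21 (ltnW s23) (tripod_swap (tripod_rot (tripod_rot tri)))) => x.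
  by have := span x; rewrite !(inE, mem_cat); case: (x \in A3) => //=; rewrite ?orbT ?orbF.
move=> tri span.
have cut n1 n2 n3 : tripod c (take n1 A1) (take n2 A2) (take n3 A3).
  case: tri => un [p1 p2 p3]; split; last by rewrite !take_path.
  apply: subseq_uniq un; rewrite /= eqxx.
  by apply: cat_subseq; last apply: cat_subseq; apply: take_subseq.
case: A3 s31 s32 tri span cut => [|z A3] s31 s32 tri span cut.
  apply: (ade_of_tripod (T := TypeA (size A1 + size A2)) tri) => //=.
    by rewrite addn0.
  by move=> a b; case: (b =P size A1 + (size A2).+1); lia.
case: A3 s31 s32 tri span cut => [|z' A3] s31 s32 tri span cut; last first.
  have [n1 n2] : 2 <= size A1 /\ 2 <= size A2 by move: s31 s32 => /=; lia.
  exfalso; apply: finite_type.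
  by apply: (@long_arms c _ _ _ 3 1 1 1 (cut 2 2 2)); rewrite ?size_takel.
rewrite /= in s31 s32; case: (ltnP 2 (size A2)) => [s2|s2].
  have n1 := leq_trans s2 s21; exfalso; apply: finite_type.
  by apply: (@long_arms c _ _ _ 4 1 1 2 (cut 3 3 1)); rewrite ?size_takel.
case: (ltnP 1 (size A2)) => [s2'|s2'].
  case: (ltnP 4 (size A1)) => [s1|s1].
    exfalso; apply: finite_type.
    by apply: (@long_arms c _ _ _ 6 1 2 3 (cut 5 2 1)); rewrite ?size_takel.
  have s1' : size A1 - 2 < 3 by lia.
  apply: (ade_of_tripod (T := TypeE (Ordinal s1')) (tripod_swap tri)) => //=.
  - by move=> x; have := span x; rewrite !(inE, mem_cat) [(_ \in A1) || _]orbCA.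
  - by lia.
  - by move=> a b; case: (b =P size A2 + (size A1).+1); lia.
apply: (ade_of_tripod (T := TypeD (size A1).-1) tri) => //=; first by lia.
by move=> a b; case: (b =P size A1 + (size A2).+1); lia.
Qed.

End Multigraph.

(** * Paths in the repetition quiver *)

Section Double.
Local Open Scope ring_scope.
Variable Q : finquiver.

Local Notation darr := (farr Q + farr Q)%type.

(** An element [inl a] is the arrow a, and [inr a] the arrow opposite to a.  A path
    of the repetition quiver is determined by its source and a word in these. *)
Definition dsrc (b : darr) : fvert Q :=
  match b with inl a => fsrc a | inr a => ftgt a end.

Definition dtgt (b : darr) : fvert Q :=
  match b with inl a => ftgt a | inr a => fsrc a end.

Definition star (b : darr) : darr :=
  match b with inl a => inr a | inr a => inl a end.

Definition zvert : choiceType := (fvert Q * int)%type.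

Definition up (x : zvert) : zvert := (x.1, x.2 + 1).

Definition step (b : darr) (x : zvert) : zvert :=
  (dtgt b, if b is inr _ then x.2 + 1 else x.2).

Fixpoint dpath (x y : zvert) (s : seq darr) : bool :=
  if s is b :: s' then (dsrc b == x.1) && dpath (step b x) y s' else x == y.

Lemma starK : involutive star. Proof. by case. Qed.
Lemma dsrc_star b : dsrc (star b) = dtgt b. Proof. by case: b. Qed.
Lemma dtgt_star b : dtgt (star b) = dsrc b. Proof. by case: b. Qed.

Lemma up_inj : injective up.
Proof. by case=> i p [j q] [-> /addIr ->]. Qed.

Lemma step_star b x : dtgt b = x.1 -> step b (step (star b) x) = up x.
Proof. by case: b x => a [i p] /= <-. Qed.

Lemma dpath_cat x y z s t : dpath x y s -> dpath y z t -> dpath x z (s ++ t).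
Proof.
elim: s x => [|b s IHs] x /=; first by move/eqP->.
by case/andP=> -> ps pt; apply: IHs.
Qed.

End Double.

Notation darr Q := (farr Q + farr Q)%type.

Section QuiverWeights.
Variable Q : finquiver.

Definition mult (i j : fvert Q) : nat := #|[set a | joined i j a]|.

Lemma mult_sym i j : mult i j = mult j i.
Proof. by apply: eq_card => a; rewrite !inE /joined orbC. Qed.

Hypothesis Qacyclic : acyclic Q.

Lemma no_loop (a : farr Q) : fsrc a != ftgt a.
Proof.
apply/eqP => aa; have /Qacyclic // : @is_path Q (fsrc a) (fsrc a) [:: a].
by rewrite /= aa !eqxx.
Qed.

Lemma mult_irr i : mult i i = 0.
Proof.
apply: eq_card0 => a; rewrite !inE /joined orbb; apply/negP => /andP[/eqP ai /eqP ia].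
by have := no_loop a; rewrite ai ia eqxx.
Qed.

Lemma sum_mult (d : fvert Q -> nat) i :
  \sum_j mult i j * d j = \sum_(b : darr Q | dsrc b == i) d (dtgt b).
Proof.
transitivity (\sum_(a : farr Q) \sum_j joined i j a * d j).
  rewrite exchange_big; apply: eq_bigr => j _ /=.
  rewrite -big_distrl /=; congr (_ * _); rewrite /mult -sum1_card big_mkcond /=.
  by apply: eq_bigr => a _; rewrite inE; case: joined.
rewrite big_sumType /= [X in _ = X + _]big_mkcond [X in _ = _ + X]big_mkcond /=.
rewrite -big_split /=; apply: eq_bigr => a _.
transitivity (\sum_j ((ftgt a == j) * ((fsrc a == i) * d j)
              + (fsrc a == j) * ((ftgt a == i) * d j))).
  apply: eq_bigr => j _; rewrite /joined; have := no_loop a.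
  case: (fsrc a =P i) => [<-|_]; case: (ftgt a =P j) => [<-|_] /=;
    rewrite ?(negPf (no_loop a)) ?[ftgt a == fsrc a]eq_sym ?(negPf (no_loop a)) //=; 
    rewrite ?andbF //=; case: (fsrc a == j); case: (ftgt a == i); lia.
have pick x (F : fvert Q -> nat) : \sum_j (x == j) * F j = F x.
  rewrite (bigD1 x) //= eqxx mul1n big1 ?addn0 // => j.
  by rewrite eq_sym => /negPf->.
by rewrite big_split /= !pick; case: eqP; case: eqP; rewrite ?mul1n ?mul0n.
Qed.

Lemma ade_dynkin : is_ade mult -> dynkin Q.
Proof.
case=> T [x0 [l [ul sl lV mE]]].
have lt (x : fvert Q) : index x l < ade_rank T by rewrite -sl index_mem.
exists 1, (fun=> T), (fun x => existT (fun _ : 'I_1 => 'I_(ade_rank T)) ord0 (Ordinal (lt x))).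
split; last first.
  move=> i j; rewrite /ade_union_adj [tag _ == tag _]eqxx [RHS]/= -mE ?lt //.
  by rewrite !nth_index.
exists (fun y : {_ : 'I_1 & 'I_(ade_rank T)} => nth x0 l (nat_of_ord (tagged y)))
  => [x|[p y]] /=; first by rewrite nth_index.
rewrite (ord1 p); congr existT; apply: val_inj => /=.
by rewrite index_uniq ?sl.
Qed.

(** Dichotomy: a superadditive vector, spread over the connected graph, or a
    spanning tripod, which shows that the graph is a Dynkin diagram. *)
Lemma exists_weights : connected_quiver Q -> ~ dynkin Q ->
  exists2 d : fvert Q -> nat, forall i, 0 < d i &
    forall i, 2 * d i <= \sum_(b : darr Q | dsrc b == i) d (dtgt b).
Proof.
case=> /card_gt0P[x0 _] conn ndyn.
have connE x y : connect (edge mult) x y.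
  rewrite -(eq_connect (e := fun x y => [exists a, joined x y a])) //.
  move=> i j; rewrite /edge /mult; apply/existsP/card_gt0P => -[a].
    by move=> ija; exists a; rewrite inE.
  by rewrite inE; exists a.
have [inf|fin] := pselect (infinite_type mult).
  have [d0 sd pd] := inf.
  have [d sd' pd'] := superadditive_pos mult_sym connE sd pd.
  by exists d => // i; rewrite -sum_mult.
case: ndyn; apply: ade_dynkin.
have [c [A1 [A2 [A3 [tri span]]]]] := spanning_tripod mult_sym mult_irr fin x0 connE.
exact: (ade_of_spanning mult_sym mult_irr fin tri span).
Qed.

End QuiverWeights.

Local Open Scope ring_scope.

(** * Normal words in the mesh category *)

Section Levels.
Variables (k : fieldType) (Q : finquiver).
Local Notation zvert := (zvert Q).
Local Notation darr := (darr Q).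

(** The rows of J are the basis of a subspace of the functions on P.  The
    coordinates outside CE.1 form a complement, and CE.2 is the projection onto
    the subspace along this complement. *)
Definition splitting (a : nat) (P : finType) (J : 'I_a -> P -> k)
    (CE : {set P} * (P -> 'I_a -> k)) : Prop :=
  [/\ forall m m', \sum_p J m p * CE.2 p m' = (m == m')%:R,
      forall p m, p \notin CE.1 -> CE.2 p m = 0 &
      {in CE.1 &, forall p p', \sum_m CE.2 p m * J m p' = (p == p')%:R}].

(** Some square submatrix of J of full size is invertible; CE.1 is its set of
    columns.  Independence is a premise inside the existential, so that a
    splitting can be chosen before independence is known. *)
Lemma exists_splitting (a : nat) (P : finType) (J : 'I_a -> P -> k) :
  exists CE, (forall v : 'rV_a, (forall p, \sum_m v 0 m * J m p = 0) -> v = 0)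
    -> splitting J CE.
Proof.
have [Jfree|nfree] := pselect
  (forall v : 'rV_a, (forall p, \sum_m v 0 m * J m p = 0) -> v = 0); last first.
  by exists (set0, fun _ _ => 0).
pose A := \matrix_(i < #|P|, m < a) J m (enum_val i).
have fullA : row_full A.
  rewrite -[row_full _]/(\rank A == a) -mxrank_tr.
  apply/inj_row_free => v vA; apply: Jfree => p.
  move/rowP: vA => /(_ (enum_rank p)); rewrite !mxE => vA0.
  by rewrite -[RHS]vA0; apply: eq_bigr => m _; rewrite !mxE enum_rankK.
pose f := fullrankfun fullA; pose M := rowsub f A.
have Munit : M \in unitmx by apply: fullrowsub_unit.
have ev_inj : injective (fun i => enum_val (f i) : P).
  by move=> i j /enum_val_inj/fullrankfun_inj.
pose E p m := \sum_i (enum_val (f i) == p)%:R * invmx M m i.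
have EE i m : E (enum_val (f i)) m = invmx M m i.
  rewrite /E (bigD1 i) //= eqxx mul1r big1 ?addr0 // => j ji.
  by rewrite (inj_eq ev_inj) (negPf ji) mul0r.
exists ([set enum_val (f i) | i : 'I_a], E) => _; split=> /=.
- move=> m m'.
  transitivity (\sum_i M i m * invmx M m' i).
    under eq_bigr do rewrite /E mulr_sumr.
    rewrite exchange_big /=; apply: eq_bigr => i _.
    rewrite (bigD1 (enum_val (f i))) //= eqxx mul1r big1 ?addr0.
      by rewrite !mxE.
    by move=> p; rewrite eq_sym => /negPf->; rewrite mul0r mulr0.
  have /matrixP/(_ m' m) := mulVmx Munit; rewrite !mxE eq_sym => <-.
  by apply: eq_bigr => i _; rewrite mulrC.
- move=> p m pC; apply: big1 => i _; case: eqP => [Dp|]; last by rewrite mul0r.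
  by case/imsetP: pC; exists i.
- move=> _ _ /imsetP[i _ ->] /imsetP[j _ ->].
  rewrite (inj_eq ev_inj); have /matrixP/(_ j i) := mulmxV Munit.
  rewrite !mxE eq_sym => <-; apply: eq_bigr => m _.
  by rewrite EE mulrC !mxE.
Qed.

(** Two consecutive lengths n and n+1 of the morphisms, in the mesh category, out
    of a fixed vertex of the repetition quiver: bases indexed by ['I_lo] and
    ['I_hi], the ends of the basis elements, and for each arrow b the matrix of
    the composition with b.  Vectors are row vectors. *)
Record level := Level {
  lo : nat;
  hi : nat;
  lo_at : 'I_lo -> zvert;
  hi_at : 'I_hi -> zvert;
  tr : darr -> 'M[k]_(lo, hi)
}.

Section Next.
Variable L : level.

(** Going from m by [star p.1] and then by p.1 is one term of the mesh relation
    that starts at the end of m.  The pairs p span the words of length n+2, and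
    the vector of coefficients at p, for fixed m, is this mesh relation. *)
Definition rel_coef (m : 'I_(lo L)) (p : darr * 'I_(hi L)) : k :=
  tr L (star p.1) m p.2.

Definition split_data := projT1 (cid (exists_splitting rel_coef)).

Definition composable (p : darr * 'I_(hi L)) : bool :=
  dsrc p.1 == (hi_at p.2).1.

Definition arrival (p : darr * 'I_(hi L)) : zvert := step p.1 (hi_at p.2).

(** Only the entries compatible with the ends of the basis elements are kept.
    The mesh relations are homogeneous for these labels, so the homogeneous
    part of a projection onto their span is again such a projection. *)
Definition quo (b : darr) : 'M[k]_(hi L, lo L) :=
  \matrix_(l, m) if composable (b, l) && (arrival (b, l) == up (lo_at m))
    then split_data.2 (b, l) m else 0.

Definition normal_pairs := [set p | composable p & p \notin split_data.1].

Definition parent (t : 'I_#|normal_pairs|) : darr * 'I_(hi L) := enum_val t.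

(** Length n+2: the cokernel of the mesh relations, which has the normal pairs as
    a basis.  The transition expands any pair in this basis. *)
Definition next : level := {|
  lo := hi L;
  hi := #|normal_pairs|;
  lo_at := @hi_at L;
  hi_at := fun t => arrival (parent t);
  tr := fun b => \matrix_(l, t)
    if composable (b, l) && (arrival (b, l) == arrival (parent t))
    then ((b, l) == parent t)%:R - \sum_m quo b l m * rel_coef m (parent t)
    else 0
|}.

Definition typed : Prop := forall b m l, tr L b m l != 0 ->
  dsrc b = (lo_at m).1 /\ hi_at l = step b (lo_at m).

(** Injectivity of the mesh map, the property special to the non Dynkin case. *)
Definition independent : Prop :=
  forall v : 'rV_(lo L), (forall b, v *m tr L b = 0) -> v = 0.

Hypothesis Ltyped : typed.

Lemma rel_coef_neq0 m p : rel_coef m p != 0 ->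
  composable p /\ arrival p = up (lo_at m).
Proof.
case: p => b l /Ltyped[]; rewrite dsrc_star /= => bm lm; split.
  by rewrite /composable /= lm /= dtgt_star.
by rewrite /arrival /= lm step_star.
Qed.

Lemma quo_neq0 b l m : quo b l m != 0 ->
  composable (b, l) /\ arrival (b, l) = up (lo_at m).
Proof. by rewrite mxE; case: ifP => [/andP[? /eqP]|]; rewrite ?eqxx. Qed.

Lemma normal_composable t : composable (parent t).
Proof. by have := enum_valP t; rewrite inE => /andP[]. Qed.

Hypothesis Lind : independent.

Lemma split_dataP : splitting rel_coef split_data.
Proof.
rewrite /split_data; case: cid => CE /= H; apply: H => v v0.
apply: Lind => b; apply/rowP => l; rewrite !mxE -[RHS](v0 (star b, l)).
by apply: eq_bigr => m _; rewrite /rel_coef /= starK.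
Qed.

Lemma parent_quo t m : quo (parent t).1 (parent t).2 m = 0.
Proof.
rewrite mxE; case: ifP => // _; have [_ E0 _] := split_dataP.
rewrite -surjective_pairing E0 //.
by have := enum_valP t; rewrite inE => /andP[].
Qed.

Lemma parent_tr t t' :
  tr next (parent t).1 (parent t).2 t' = (t == t')%:R.
Proof.
rewrite mxE -surjective_pairing normal_composable /=.
under eq_bigr do rewrite parent_quo mul0r.
rewrite sumr_const mul0rn subr0 (inj_eq enum_val_inj).
by have [->|] := eqVneq t t'; rewrite ?eqxx // if_same.
Qed.

Lemma rel_coef_quo m m' :
  \sum_p rel_coef m p * quo p.1 p.2 m' = (m == m')%:R.
Proof.
have [EJ _ _] := split_dataP.
have [mm'|mm'] := eqVneq (lo_at m) (lo_at m').
  rewrite -EJ; apply: eq_bigr => p _.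
  have [->|/rel_coef_neq0[cp ap]] := eqVneq (rel_coef m p) 0.
    by rewrite !mul0r.
  by rewrite mxE -surjective_pairing cp ap mm' eqxx.
have -> : (m == m') = false by apply: contraNF mm' => /eqP->.
apply: big1 => p _; apply/eqP; apply: contraNT mm'.
rewrite mulf_eq0 negb_or => /andP[/rel_coef_neq0[_ ap] /quo_neq0[_]].
by rewrite -surjective_pairing ap => /up_inj->.
Qed.

(** [quo] is a retraction of the mesh map. *)
Lemma tr_quo : \sum_b tr L (star b) *m quo b = 1%:M.
Proof.
apply/matrixP => m m'; rewrite summxE mxE -rel_coef_quo.
rewrite -(pair_bigA _ (fun b l => tr L (star b) m l * quo b l m')) /=.
by apply: eq_bigr => b _; rewrite mxE.
Qed.

(** A pair is the sum of its normal form and of mesh relations. *)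
Lemma pair_decomposition p p' : composable p ->
  (p == p')%:R = \sum_t tr next p.1 p.2 t * (parent t == p')%:R
                 + \sum_m quo p.1 p.2 m * rel_coef m p'.
Proof.
move=> cp; have [EJ E0 JE] := split_dataP.
have labels : arrival p != arrival p' ->
    \sum_m quo p.1 p.2 m * rel_coef m p' = 0.
  move=> app'; apply: big1 => m _; apply/eqP; apply: contraNT app'.
  rewrite mulf_eq0 negb_or => /andP[/quo_neq0[_ +] /rel_coef_neq0[_ ->]].
  by rewrite -surjective_pairing => ->.
have [p'n|p'n] := boolP (p' \in normal_pairs).
  pose t := enum_rank_in p'n p'; have Dt : parent t = p'.
    by rewrite /parent enum_rankK_in.
  rewrite (bigD1 t) //= Dt eqxx mulr1 big1 ?addr0; last first.
    move=> t' t't; rewrite -Dt (inj_eq enum_val_inj) (negPf t't).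
    by rewrite mulr0.
  rewrite mxE -surjective_pairing cp Dt /=; case: ifP => [_|]; first by rewrite subrK.
  move/negbT => app'; rewrite labels // addr0.
  by rewrite (_ : _ == _ = false) //; apply: contraNF app' => /eqP->.
rewrite big1 ?add0r; last first.
  move=> t _; rewrite (_ : _ == _ = false) ?mulr0 //.
  by apply: contraNF p'n => /eqP <-; apply: enum_valP.
have [app'|app'] := eqVneq (arrival p) (arrival p'); last first.
  rewrite labels // (_ : _ == _ = false) //.
  by apply: contraNF app' => /eqP->.
have [cp'|ncp'] := boolP (composable p'); last first.
  have -> : (p == p') = false by apply: contraNF ncp' => /eqP<-.
  rewrite big1 // => m _; have [->|] := eqVneq (rel_coef m p') 0.
    by rewrite mulr0.
  by case/rel_coef_neq0; rewrite (negPf ncp').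
have p'C : p' \in split_data.1.
  by move: p'n; rewrite inE cp' /= negbK.
have -> : \sum_m quo p.1 p.2 m * rel_coef m p'
        = \sum_m split_data.2 p m * rel_coef m p'.
  apply: eq_bigr => m _; have [->|] := eqVneq (rel_coef m p') 0.
    by rewrite !mulr0.
  case/rel_coef_neq0 => _ ap'; rewrite mxE -surjective_pairing cp app' ap'.
  by rewrite eqxx.
have [pC|pC] := boolP (p \in split_data.1); first by rewrite JE.
rewrite big1 => [|m _]; last by rewrite E0 ?mul0r.
by rewrite (_ : _ == _ = false) //; apply: contraNF pC => /eqP->.
Qed.

Lemma next_typed b l t : tr next b l t != 0 ->
  dsrc b = (@lo_at next l).1 /\ @hi_at next t = step b (@lo_at next l).
Proof.
rewrite mxE; case: ifP => [/andP[/eqP cb /eqP ab] _|]; last by rewrite eqxx.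
by split=> //; rewrite -[hi_at t]/(arrival (parent t)) -ab.
Qed.

(** The mesh relations hold in the cokernel. *)
Lemma tr_mesh : \sum_b tr L (star b) *m tr next b = 0.
Proof.
apply/matrixP => m t; rewrite summxE [RHS]mxE.
transitivity (\sum_(p : darr * 'I_(hi L)) rel_coef m p * tr next p.1 p.2 t).
  rewrite -(pair_bigA _ (fun b l => tr L (star b) m l * tr next b l t)) /=.
  by apply: eq_bigr => b _; rewrite mxE.
have trE p : composable p -> tr next p.1 p.2 t =
    (p == parent t)%:R - \sum_m' quo p.1 p.2 m' * rel_coef m' (parent t).
  move=> cp; rewrite (pair_decomposition (parent t) cp) addrK.
  rewrite (bigD1 t) //= eqxx mulr1 big1 ?addr0 // => t' t't.
  by rewrite (inj_eq enum_val_inj) (negPf t't) mulr0.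
transitivity (\sum_p (rel_coef m p * (p == parent t)%:R -
    \sum_m' rel_coef m p * quo p.1 p.2 m' * rel_coef m' (parent t))).
  apply: eq_bigr => p _.
  have [->|/rel_coef_neq0[cp _]] := eqVneq (rel_coef m p) 0.
    by rewrite !mul0r big1 ?subr0 // => m' _; rewrite !mul0r.
  rewrite trE // mulrBr mulr_sumr; congr (_ - _).
  by apply: eq_bigr => m' _; rewrite mulrA.
rewrite sumrB (bigD1 (parent t)) //= eqxx mulr1 big1 ?addr0; last first.
  by move=> p /negPf->; rewrite mulr0.
rewrite exchange_big /=; under eq_bigr do rewrite -mulr_suml.
under eq_bigr do rewrite rel_coef_quo.
rewrite (bigD1 m) //= eqxx mul1r big1 ?addr0 ?subrr // => m' m'm.
by rewrite eq_sym (negPf m'm) mul0r.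
Qed.

End Next.

Definition start (u : zvert) : level := {|
  lo := 0; hi := 1;
  lo_at := fun=> u;
  hi_at := fun=> up u;
  tr := fun=> 0
|}.

Definition levels (u : zvert) (n : nat) : level := iter n next (start u).

End Levels.

(** * Growth of weighted dimensions *)

Lemma linear_hom (k : fieldType) (U V : vectType k) (f : U -> V) :
  linear f -> exists g : 'Hom(U, V), g =1 f.
Proof.
move=> f_lin; pose fL : {linear U -> V} :=
  HB.pack f (GRing.isLinear.Build k U V *:%R f f_lin).
by exists (linfun fL) => v; rewrite lfunE.
Qed.

Lemma dimv_img (k : fieldType) (U V : vectType k) (f : 'Hom(U, V))
  (X : {vspace U}) : (\dim (f @: X) <= \dim X)%N.
Proof. by rewrite -(limg_ker_dim f X) leq_addl. Qed.

Section Growth.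
Variables (k : fieldType) (Q : finquiver) (d : fvert Q -> nat).
Local Notation zvert := (zvert Q).
Local Notation darr := (darr Q).
Hypothesis d_gt0 : forall i, (0 < d i)%N.
Hypothesis d_super : forall i, (2 * d i <= \sum_(b : darr | dsrc b == i) d (dtgt b))%N.

Definition over n (at_ : 'I_n -> zvert) (i : fvert Q) (v : 'rV[k]_n) : Prop :=
  forall l, v 0 l != 0 -> (at_ l).1 = i.

Lemma over_space n (at_ : 'I_n -> zvert) i :
  exists U : {vspace 'rV[k]_n}, forall v, (v \in U) <-> over at_ i v.
Proof.
have [g gE] := @linear_hom _ _ _
  (mulmxr (diag_mx (\row_l ((at_ l).1 != i)%:R)) : 'rV[k]_n -> 'rV[k]_n)
  (linearP _).
exists (lker g) => v; rewrite memv_ker gE /=; split=> [/eqP/rowP v0 l vl|ov].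
  have := v0 l; rewrite mul_mx_diag !mxE; case: eqP => // _.
  by rewrite mulr1 => vl0; rewrite vl0 eqxx in vl.
apply/eqP/rowP => l; rewrite mul_mx_diag !mxE.
have [->|/ov->] := eqVneq (v 0 l) 0; first by rewrite mul0r.
by rewrite eqxx mulr0.
Qed.

(** X and Y are families of subspaces in two consecutive lengths, graded by the
    vertices of the quiver, and the arrows map X into Y.  Quantifying over all
    such families, and not only over the lines, is what makes the induction on
    the length possible. *)
Definition growing (L : level k Q) : Prop :=
  forall (X : fvert Q -> {vspace 'rV_(lo L)}) (Y : fvert Q -> {vspace 'rV_(hi L)}),
  (forall i v, v \in X i -> over (@lo_at _ _ L) i v) ->
  (forall i v, v \in Y i -> over (@hi_at _ _ L) i v) ->
  (forall b v, v \in X (dsrc b) -> v *m tr L b \in Y (dtgt b)) ->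
  (exists i, X i != 0%VS \/ Y i != 0%VS) ->
  (\sum_i d i * \dim (X i) < \sum_i d i * \dim (Y i))%N.

Lemma sum_dim_gt0 n (Y : fvert Q -> {vspace 'rV[k]_n}) i :
  Y i != 0%VS -> (0 < \sum_j d j * \dim (Y j))%N.
Proof.
move=> Yi; rewrite (bigD1 i) //= addn_gt0 muln_gt0 d_gt0 lt0n dimv_eq0.
by rewrite Yi.
Qed.

Lemma start_growing (u : zvert) : growing (start k u).
Proof.
move=> X Y _ _ _ [i XY].
have X0 j : X j = 0%VS.
  by apply/eqP; rewrite -subv0; apply/subvP => v _; rewrite [v]thinmx0 mem0v.
rewrite big1 => [|j _]; last by rewrite X0 dimv0 muln0.
by apply: (@sum_dim_gt0 _ Y i); case: XY; rewrite // X0 eqxx.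
Qed.

(** The components of a vector killed by all arrows span a family X with Y = 0. *)
Lemma growing_independent L : typed L -> growing L -> independent L.
Proof.
move=> Lt Lg v v0; apply/eqP; apply: contraT => vn0.
pose c i : 'rV_(lo L) := \row_l (if (lo_at l).1 == i then v 0 l else 0).
suff : (\sum_i d i * \dim <[c i]>%VS
    < \sum_(i : fvert Q) d i * \dim (0%VS : {vspace 'rV[k]_(hi L)}))%N.
  by under [X in (_ < X)%N]eq_bigr do rewrite dimv0 muln0; rewrite sum_nat_const muln0.
apply: (Lg (fun i => <[c i]>%VS) (fun=> 0%VS)).
- move=> i _ /vlineP[a ->] l; rewrite !mxE; case: ((lo_at l).1 =P i) => // _.
  by rewrite mulr0 eqxx.
- by move=> i w; rewrite memv0 => /eqP-> l; rewrite mxE eqxx.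
- move=> b _ /vlineP[a ->]; rewrite memv0 -scalemxAl.
  suff -> : c (dsrc b) *m tr L b = v *m tr L b by rewrite v0 scaler0.
  apply/rowP => h; rewrite !mxE; apply: eq_bigr => l _; rewrite mxE.
  have [->|/Lt[-> _]] := eqVneq (tr L b l h) 0; first by rewrite !mulr0.
  by rewrite eqxx.
have [l vl] : exists l, v 0 l != 0.
  apply/existsP; apply: contraR vn0 => /existsPn vl.
  by apply/eqP/rowP => l; rewrite mxE; apply/eqP; have := vl l; rewrite negbK.
exists (lo_at l).1; left; rewrite -dimv_eq0 dim_vline eqb0 negbK.
by apply: contraNneq vl => /rowP/(_ l); rewrite !mxE eqxx => ->.
Qed.

Section NextGrowing.
Variable L : level k Q.
Hypotheses (Lt : typed L) (Li : independent L).
Variables (X : fvert Q -> {vspace 'rV[k]_(hi L)}).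
Variables (Y : fvert Q -> {vspace 'rV[k]_(hi (next L))}).
Hypothesis Xover : forall i v, v \in X i -> over (@hi_at _ _ L) i v.
Hypothesis XY : forall b v, v \in X (dsrc b) -> v *m tr (next L) b \in Y (dtgt b).

(** W is the largest subspace over i that the arrows out of i map into X. *)
Definition pullback_spec i (W : {vspace 'rV[k]_(lo L)}) : Prop :=
  forall v, (v \in W) <->
    over (@lo_at _ _ L) i v /\
    (forall b, dtgt b = i -> v *m tr L (star b) \in X (dsrc b)).

Lemma pullback i : exists W, pullback_spec i W.
Proof.
have [U UP] := over_space (@lo_at _ _ L) i.
have pre b : exists V : {vspace 'rV[k]_(lo L)},
    forall v, (v \in V) <-> (v *m tr L (star b) \in X (dsrc b)).
  have [g gE] := @linear_hom _ _ _
    (mulmxr (tr L (star b)) : 'rV[k]_(lo L) -> 'rV[k]_(hi L)) (linearP _).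
  by exists (g @^-1: X (dsrc b))%VS => v; rewrite -memv_preim gE.
have [V VP] := choice pre.
exists (U :&: \bigcap_(b | dtgt b == i) V b)%VS => v.
rewrite memv_cap; split=> [/andP[/UP ov]|[/UP-> vV]].
  rewrite -[_ \in _]/(_ <= _)%VS => /subv_bigcapP vV; split=> // b /eqP bi.
  by apply/VP; apply: vV.
rewrite -[_ \in _]/(_ <= _)%VS; apply/subv_bigcapP => b /eqP bi.
by apply/VP; apply: vV.
Qed.

(** A combination of pairs that vanishes in the cokernel is a combination of mesh
    relations, namely the one picked out by [quo]. *)
Lemma mesh_exact (z : {ffun darr -> 'rV[k]_(hi L)}) :
  (forall b, over (@hi_at _ _ L) (dsrc b) (z b)) ->
  \sum_b z b *m tr (next L) b = 0 ->
  forall b, (\sum_b' z b' *m quo L b') *m tr L (star b) = z b.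
Proof.
move=> zov z0 b; apply/rowP => l.
transitivity (\sum_(p : darr * 'I_(hi L)) z p.1 0 p.2 * (p == (b, l))%:R); last first.
  rewrite (bigD1 (b, l)) //= eqxx mulr1 big1 ?addr0 // => p /negPf->.
  by rewrite mulr0.
transitivity (\sum_(p : darr * 'I_(hi L)) z p.1 0 p.2 *
   (\sum_t tr (next L) p.1 p.2 t * (parent t == (b, l))%:R +
    \sum_m quo L p.1 p.2 m * rel_coef m (b, l))); last first.
  apply: eq_bigr => p _; have [->|zp] := eqVneq (z p.1 0 p.2) 0.
    by rewrite !mul0r.
  rewrite (pair_decomposition Lt Li) //.
  by rewrite /composable (zov _ _ zp).
under [RHS]eq_bigr do rewrite mulrDr.
rewrite big_split /= [X in _ = X + _](_ : _ = 0) ?add0r; last first.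
  under eq_bigr do rewrite mulr_sumr.
  rewrite exchange_big /= big1 // => t _.
  under eq_bigr do rewrite mulrA.
  rewrite -mulr_suml [X in X * _](_ : _ = 0) ?mul0r //.
  have /rowP/(_ t) := z0; rewrite summxE [RHS]mxE => z0t; rewrite -[RHS]z0t.
  rewrite -(pair_bigA _ (fun b l => z b 0 l * tr (next L) b l t)) /=.
  by apply: eq_bigr => b' _; rewrite [RHS]mxE.
rewrite mxE; under [RHS]eq_bigr do rewrite mulr_sumr.
rewrite exchange_big /=; apply: eq_bigr => m _.
under [RHS]eq_bigr do rewrite mulrA; rewrite -mulr_suml; congr (_ * _).
rewrite summxE -(pair_bigA _ (fun b l => z b 0 l * quo L b l m)) /=.
by apply: eq_bigr => b' _; rewrite [LHS]mxE.
Qed.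

(** Rank-nullity for the map to Y i from the direct sum Z of the X (dsrc b), over
    the arrows b into i: by exactness its kernel lies in the image of W under
    the mesh map J. *)
Lemma mesh_dim i W : pullback_spec i W ->
  (\sum_(b : darr | dtgt b == i) \dim (X (dsrc b)) <= \dim W + \dim (Y i))%N.
Proof.
move=> WP; pose Fn : vectType k := {ffun darr -> 'rV[k]_(hi L)}.
have inj_lin b : linear (fun v => [ffun b' => if b' == b then v else 0] : Fn).
  move=> c v w; apply/ffunP => b'; rewrite !ffunE; case: eqP => // _.
  by rewrite scaler0 addr0.
have [inj injE] := choice (fun b => linear_hom (inj_lin b)).
have psi_lin : linear (fun z : Fn => \sum_b z b *m tr (next L) b).
  move=> c z w; rewrite scaler_sumr -big_split /=; apply: eq_bigr => b _.
  by rewrite !ffunE mulmxDl -scalemxAl.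
have [psi psiE] := linear_hom psi_lin.
have J_lin : linear (fun v : 'rV[k]_(lo L) => [ffun b => v *m tr L (star b)] : Fn).
  by move=> c v w; apply/ffunP => b; rewrite !ffunE mulmxDl -scalemxAl.
have [J JE] := linear_hom J_lin.
pose Z : {vspace Fn} := (\sum_(b | dtgt b == i) inj b @: X (dsrc b))%VS.
have Zspec z : z \in Z ->
    (forall b, z b \in X (dsrc b)) /\ (forall b, dtgt b != i -> z b = 0).
  case/memv_sumP => us usX Dz.
  have zE b : z b = if dtgt b == i then us b b else 0.
    rewrite Dz sum_ffunE; case: ifP => bi.
      rewrite (bigD1 b) //= big1 ?addr0 // => b' /andP[b'i b'b].
      by have /memv_imgP[v _ ->] := usX b' b'i; rewrite injE ffunE eq_sym (negPf b'b).
    rewrite big1 // => b' b'i.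
    have /memv_imgP[v _ ->] := usX b' b'i; rewrite injE ffunE.
    by case: eqP => // bb'; rewrite -bb' bi in b'i.
  split=> b; rewrite zE; last by move=> /negPf->.
  case: ifP => [bi|_]; last exact: mem0v.
  by have /memv_imgP[v vX ->] := usX b bi; rewrite injE ffunE eqxx.
have dimZ : \dim Z = (\sum_(b : darr | dtgt b == i) \dim (X (dsrc b)))%N.
  have /directvP-> : directv Z.
    apply/directv_sum_independent => us usX us0 b bi.
    have /memv_imgP[v vX Dv] := usX b bi.
    have := congr1 (fun z : Fn => z b) us0; rewrite sum_ffunE ffunE.
    rewrite (bigD1 b) //= big1 ?addr0; last first.
      move=> b' /andP[b'i b'b].
      by have /memv_imgP[w _ ->] := usX b' b'i; rewrite injE ffunE eq_sym (negPf b'b).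
    rewrite Dv injE ffunE eqxx => ->.
    by apply/ffunP => b'; rewrite !ffunE if_same.
  apply: eq_bigr => b bi; apply: limg_dim_eq.
  apply/eqP; rewrite -subv0; apply/subvP => v; rewrite memv_cap memv_ker memv0 injE.
  case/andP => _ /eqP/ffunP/(_ b); rewrite !ffunE eqxx => ->; exact: eqxx.
rewrite -dimZ -(limg_ker_dim psi Z) leq_add //.
  apply: leq_trans (dimv_img J W); apply/dimvS/subvP => z.
  rewrite memv_cap memv_ker psiE => /andP[/Zspec[zX zi] /eqP z0].
  have zov b : over (@hi_at _ _ L) (dsrc b) (z b) by apply/Xover/zX.
  have zJ := mesh_exact zov z0.
  have -> : z = J (\sum_b z b *m quo L b).
    by rewrite JE; apply/ffunP => b; rewrite ffunE zJ.
  apply: memv_img; apply/WP; split=> [m|b bi]; last by rewrite zJ zX.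
  rewrite summxE => /eqP; apply: contra_not_eq => mi; apply: big1 => b _.
  rewrite mxE; apply: big1 => l _.
  have [bi|bi] := eqVneq (dtgt b) i; last by rewrite zi // mxE mul0r.
  have [->|/quo_neq0[_ /(congr1 fst)/= bm]] := eqVneq (quo L b l m) 0.
    by rewrite mulr0.
  by rewrite -bm bi eqxx in mi.
apply/dimvS/subvP => _ /memv_imgP[z /Zspec[zX zi] ->]; rewrite psiE.
apply: memv_suml => b _; have [<-|bi] := eqVneq (dtgt b) i; first exact/XY/zX.
by rewrite zi // mul0mx mem0v.
Qed.

End NextGrowing.

(** Let W be the pullback of X, and w, x, y the weighted dimensions of W, X, Y.
    Then w < x by induction, and the sum of [mesh_dim] over all i gives
    2 x <= w + y by superadditivity; so x < y.  If X = 0 then Y is nonzero. *)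
Lemma next_growing L : typed L -> growing L -> growing (next L).
Proof.
move=> Lt Lg X Y Xov Yov XY nz; have Li := growing_independent Lt Lg.
have [/forallP X0|/forallPn[i Xi]] := boolP [forall i, X i == 0%VS].
  rewrite big1 => [|i _]; last by rewrite (eqP (X0 i)) dimv0 muln0.
  by case: nz => i [|Yi]; [rewrite X0 | apply: sum_dim_gt0 Yi].
have [W WP] := choice (pullback X).
have lt1 : (\sum_i d i * \dim (W i) < \sum_i d i * \dim (X i))%N.
  apply: Lg; [| exact: Xov | | by exists i; right].
    by move=> j v /WP[].
  move=> b v /WP[_ /(_ (star b))]; rewrite dtgt_star starK dsrc_star.
  by apply.
have le2 : (\sum_i d i * (\sum_(b : darr | dtgt b == i) \dim (X (dsrc b)))
     <= \sum_i d i * \dim (W i) + \sum_i d i * \dim (Y i))%N.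
  rewrite -big_split /= leq_sum // => j _; rewrite -mulnDr leq_mul2l.
  by rewrite (mesh_dim Lt Li Xov XY (WP j)) orbT.
have eq3 : (\sum_i d i * (\sum_(b : darr | dtgt b == i) \dim (X (dsrc b)))
     = \sum_i (\sum_(b : darr | dsrc b == i) d (dtgt b)) * \dim (X i))%N.
  transitivity (\sum_(b : darr) d (dtgt b) * \dim (X (dsrc b)))%N.
    rewrite [RHS](partition_big (@dtgt Q) predT) //=; apply: eq_bigr => j _.
    by rewrite big_distrr; apply: eq_bigr => b /eqP->.
  rewrite (partition_big (@dsrc Q) predT) //=; apply: eq_bigr => j _.
  by rewrite big_distrl; apply: eq_bigr => b /eqP->.
have le4 : (2 * \sum_i d i * \dim (X i) <=
    \sum_i (\sum_(b : darr | dsrc b == i) d (dtgt b)) * \dim (X i))%N.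
  by rewrite big_distrr leq_sum // => j _; rewrite /= mulnA leq_mul2r d_super orbT.
lia.
Qed.

Lemma levelsP (u : zvert) n : typed (levels k u n) /\ independent (levels k u n).
Proof.
suff [Lt Lg] : typed (levels k u n) /\ growing (levels k u n).
  by split=> //; apply: growing_independent.
elim: n => [|n [Lt Lg]].
  by split; [move=> b m l; rewrite mxE eqxx | apply: start_growing].
split; first exact: next_typed.
exact: next_growing.
Qed.

End Growth.

(** * Mesh systems *)

Section MeshSystems.
Variables (k : fieldType) (Q : finquiver) (w : zvert Q -> nat).
Local Notation zvert := (zvert Q).
Local Notation darr := (darr Q).
Local Notation lev := (@levels k Q).
Implicit Types (u v x : zvert) (s g t : seq darr).

(** A frozen vertex is named by the non frozen vertex u that has an arrow to it;
    its own arrow goes to [up u].  [Phi u x g] is meant to be the action of the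
    path from the frozen vertex u through the path g, from [up u] to x, to the
    frozen vertex x. *)
Definition family := forall u x, seq darr -> 'M[k]_(w x, w u).

(** The left hand side is the action of the two-step paths from v to [up v] through
    non frozen vertices, between g and s; the right hand side is minus the
    action of the one through the frozen vertex v. *)
Definition mesh_system (Phi : family) : Prop :=
  forall u v x g s, dpath (up u) v g -> dpath (up v) x s ->
  \sum_(b : darr | dtgt b == v.1) Phi u x (g ++ star b :: b :: s) =
    - (Phi v x s *m Phi u v g).

Fixpoint nword u n : 'I_(hi (lev u n)) -> seq darr :=
  match n with
  | 0 => fun _ => [::]
  | n'.+1 => fun l => rcons (nword (parent l).2) (parent l).1
  end.

Section Extension.
Variable A : forall u x n, 'I_(hi (lev u n)) -> 'M[k]_(w x, w u).

(** [ext_rec] computes the value of the mesh system on the normal word l followed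
    by s, and [corr_rec] its value on the mesh relation at the end of m, written in the
    pairs of [rel_coef], followed by s.  To append an arrow b to l, expand the
    pair (b, l) by [pair_decomposition].  The mesh relation after m, written with
    paths, has the value prescribed by [mesh_system]; the difference to its
    form in the pairs consists of mesh relations of smaller length.  The number
    N bounds the total length of l and s, which does not grow in these calls
    and drops in those that [corr_rec] makes to [Phi0]. *)
Fixpoint corr_rec u x (Phi0 : forall v, seq darr -> 'M[k]_(w x, w v)) n :
    'I_(lo (lev u n)) -> seq darr -> 'M[k]_(w x, w u) :=
  match n with
  | 0 => fun _ _ => 0
  | n'.+1 => fun m s =>
      - (Phi0 (lo_at m) s *m @A u (lo_at m) n' m)
      - \sum_(b : darr) \sum_m'
          quo (lev u n') (star b) m m' *: corr_rec Phi0 m' (b :: s)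
  end.

Fixpoint ext_rec (N : nat) u x s n : 'I_(hi (lev u n)) -> 'M[k]_(w x, w u) :=
  if N isn't N'.+1 then fun=> 0 else
  (fix run s n : 'I_(hi (lev u n)) -> 'M[k]_(w x, w u) :=
    match s with
    | [::] => fun l => @A u x n l
    | b :: s' => fun l =>
        \sum_l' tr (lev u n.+1) b l l' *: run s' n.+1 l' +
        \sum_m quo (lev u n) b l m *:
          corr_rec (fun v t => @ext_rec N' v x t 0 ord0) m s'
    end) s n.

Arguments ext_rec : simpl never.

Lemma ext_rec_cons N u x b s n (l : 'I_(hi (lev u n))) :
  @ext_rec N.+1 u x (b :: s) n l =
    \sum_l' tr (lev u n.+1) b l l' *: @ext_rec N.+1 u x s n.+1 l' +
    \sum_m quo (lev u n) b l m *:
      corr_rec (fun v t => @ext_rec N v x t 0 ord0) m s.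
Proof. by []. Qed.

Lemma corr_rec_fuel u x Phi0 Phi1 n (m : 'I_(lo (lev u n))) s N :
  (forall v t, (size t < N)%N -> Phi0 v t = Phi1 v t) ->
  (n + size s <= N)%N ->
  @corr_rec u x Phi0 n m s = corr_rec Phi1 m s.
Proof.
move=> eqPhi; elim: n m s => [|n IHn] m s //= nsN.
rewrite eqPhi; last by lia.
congr (_ - _); apply: eq_bigr => b _; apply: eq_bigr => m' _.
by rewrite IHn // addnS.
Qed.

Lemma ext_rec_fuel N M u x s n (l : 'I_(hi (lev u n))) :
  (n + size s < N)%N -> (n + size s < M)%N ->
  @ext_rec N u x s n l = ext_rec M x s l.
Proof.
elim: N M u x s n l => [|N IHN] [|M] u x s n l; try by lia.
elim: s n l => [|b s IHs] n l //= nN nM; rewrite !ext_rec_cons.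
congr (_ + _); apply: eq_bigr => l' _.
  by congr (_ *: _); apply: IHs; lia.
congr (_ *: _); apply: (@corr_rec_fuel _ _ _ _ _ _ _ (n + size s)) => // v t ts.
by apply: IHN; lia.
Qed.

Definition ext u x n (l : 'I_(hi (lev u n))) s : 'M[k]_(w x, w u) :=
  @ext_rec (n + size s).+1 u x s n l.
Arguments ext u x [n] l s.

Definition extension : family := fun u x s => @ext u x 0 ord0 s.

Definition corr u x n (m : 'I_(lo (lev u n))) s : 'M[k]_(w x, w u) :=
  corr_rec (fun v t => extension v x t) m s.
Arguments corr u x [n] m s.

Lemma ext_nil u x n (l : 'I_(hi (lev u n))) : ext u x l [::] = A x l.
Proof. by []. Qed.

Lemma ext_cons u x n (l : 'I_(hi (lev u n))) b s :
  ext u x l (b :: s) =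
    \sum_l' tr (lev u n.+1) b l l' *: @ext u x n.+1 l' s +
    \sum_m quo (lev u n) b l m *: corr u x m s.
Proof.
rewrite /ext ext_rec_cons; congr (_ + _); apply: eq_bigr => i _; congr (_ *: _).
  by apply: (@ext_rec_fuel _ _ u x _ n.+1) => /=; lia.
apply: (@corr_rec_fuel _ _ _ _ _ _ _ (n + size s)) => // v t ts.
by apply: ext_rec_fuel => /=; lia.
Qed.

Lemma corrS u x n (m : 'I_(lo (lev u n.+1))) s :
  corr u x m s = - (extension (lo_at m) x s *m @A u (lo_at m) n m)
    - \sum_b \sum_m' quo (lev u n) (star b) m m' *: corr u x m' (b :: s).
Proof. by []. Qed.

Hypothesis levP : forall u n, typed (lev u n) /\ independent (lev u n).

Lemma lev_typed u n : typed (lev u n). Proof. by case: (levP u n). Qed.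
Lemma lev_ind u n : independent (lev u n). Proof. by case: (levP u n). Qed.

Lemma ext_bad u x n (l : 'I_(hi (lev u n))) b s :
  dsrc b != (hi_at l).1 -> ext u x l (b :: s) = 0.
Proof.
move=> bl; rewrite ext_cons !big1 ?addr0 // => i _.
  have [->|/quo_neq0[/eqP]] := eqVneq (quo (lev u n) b l i) 0.
    by rewrite scale0r.
  by move/eqP; rewrite (negPf bl).
have [->|/next_typed[/eqP]] := eqVneq (tr (lev u n.+1) b l i) 0.
  by rewrite scale0r.
by rewrite (negPf bl).
Qed.

Lemma quo_star_path u n b (m : 'I_(hi (lev u n))) m' v g :
  quo (lev u n) (star b) m m' != 0 -> dpath (up (hi_at m)) v g ->
  dpath (up (lo_at m')) v (b :: g).
Proof.
case/quo_neq0 => /eqP /= bm am pg.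
rewrite -am -[arrival _]/(step (star b) (hi_at m)); apply/andP; split.
  by have /= <- := congr1 fst am; rewrite dtgt_star.
by rewrite step_star // -bm dsrc_star.
Qed.

Lemma quo_path u n b (l : 'I_(hi (lev u n))) m v g :
  quo (lev u n) b l m != 0 -> dpath (hi_at l) v (b :: g) ->
  dpath (up (lo_at m)) v g.
Proof. by case/quo_neq0 => _ /= <- /andP[]. Qed.

Lemma tr_path u n b (l : 'I_(hi (lev u n))) l' v g :
  tr (lev u n.+1) b l l' != 0 -> dpath (hi_at l) v (b :: g) ->
  dpath (@hi_at _ _ (lev u n.+1) l') v g.
Proof. by case/next_typed => _ -> /= /andP[]. Qed.

(** A linear identity between the continuations T b that holds after the normal
    words ending at v holds after any path g ending at v, since the recursion
    reaches the continuation only through such normal words. *)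
Lemma ext_cat (P : pred darr) (T : darr -> seq darr) v x (X : 'M[k]_(w x, w v)) :
  (forall u n (l : 'I_(hi (lev u n))), hi_at l = v ->
     \sum_(b | P b) ext u x l (T b) = X *m A v l) ->
  forall u n (l : 'I_(hi (lev u n))) g, dpath (hi_at l) v g ->
    \sum_(b | P b) ext u x l (g ++ T b) = X *m ext u v l g.
Proof.
move=> base u n l g; have [N] := ubnP (n + size g); elim: N u n l g => // N IHN.
have corrN u n (m : 'I_(lo (lev u n))) g : (n + size g <= N)%N ->
    dpath (up (lo_at m)) v g ->
    \sum_(b | P b) corr u x m (g ++ T b) = X *m corr u v m g.
  elim: n m g => [[]|n IHn m g nN pg] //.
  under eq_bigr do rewrite corrS.
  rewrite corrS mulmxBr sumrB sumrN -mulmx_suml IHN //; last by rewrite add0n; lia.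
  rewrite mulmxN mulmxA; congr (_ - _); rewrite mulmx_sumr exchange_big /=.
  apply: eq_bigr => b _; rewrite mulmx_sumr exchange_big /=.
  apply: eq_bigr => m' _; rewrite -scaler_sumr -scalemxAr.
  have [->|qn] := eqVneq (quo (lev u n) (star b) m m') 0; first by rewrite !scale0r.
  by congr (_ *: _); apply: (IHn m' (b :: g)); [rewrite /=; lia | apply: quo_star_path pg].
move=> u n l g; elim: g n l => [|b g IHg] n l nN pg.
  by rewrite ext_nil base //; apply/eqP.
under eq_bigr do rewrite /= ext_cons.
rewrite ext_cons mulmxDr big_split /= exchange_big mulmx_sumr /=; congr (_ + _).
  apply: eq_bigr => l' _; rewrite -scaler_sumr -scalemxAr.
  have [->|tn] := eqVneq (tr (lev u n.+1) b l l') 0; first by rewrite !scale0r.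
  congr (_ *: _); apply: (IHg n.+1 l'); first by move: nN => /=; lia.
  exact: tr_path tn pg.
rewrite exchange_big mulmx_sumr /=; apply: eq_bigr => m _.
rewrite -scaler_sumr -scalemxAr.
have [->|qn] := eqVneq (quo (lev u n) b l m) 0; first by rewrite !scale0r.
congr (_ *: _); apply: corrN; first by move: nN => /=; lia.
exact: quo_path qn pg.
Qed.

(** By [ext_cat] it suffices to treat a normal word l in place of g.  Applying the
    recursion twice, the terms of length n+2 cancel by [tr_mesh], those with
    [quo] reduce to [corr] at l by [tr_quo], and the recursion for [corr]
    cancels the rest, up to the product on the right. *)
Lemma extension_mesh : mesh_system extension.
Proof.
move=> u v x g s pg ps.
rewrite (@ext_cat (fun b => dtgt b == v.1) (fun b => star b :: b :: s) v x
  (- extension v x s)) // ?mulNmx //.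
move=> {g pg}u n l lv.
transitivity (\sum_b ext u x l (star b :: b :: s)).
  rewrite big_mkcond; apply: eq_bigr => b _; case: ifP => // /negbT bv.
  by rewrite ext_bad // dsrc_star lv.
transitivity (\sum_b (\sum_l' tr (lev u n.+1) (star b) l l' *:
    (\sum_l'' tr (lev u n.+2) b l' l'' *: @ext u x n.+2 l'' s +
     \sum_m quo (lev u n.+1) b l' m *: @corr u x n.+1 m s)
  + \sum_m' quo (lev u n) (star b) l m' *: corr u x m' (b :: s))).
  apply: eq_bigr => b _; rewrite ext_cons.
  apply: (f_equal2 +%R); last by [].
  by apply: eq_bigr => l' _; rewrite ext_cons.
under eq_bigr => b _ do under eq_bigr => l' _ do rewrite scalerDr.
under eq_bigr => b _ do rewrite big_split /=.
rewrite !big_split /= [X in X + _ + _](_ : _ = 0) ?add0r; last first.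
  have /matrixP meshE := tr_mesh (@lev_typed u n.+1) (@lev_ind u n.+1).
  transitivity (\sum_l'' (\sum_b tr (lev u n.+1) (star b) *m tr (lev u n.+2) b) l l''
      *: @ext u x n.+2 l'' s).
    under [RHS]eq_bigr => l'' _ do rewrite summxE scaler_suml.
    rewrite [RHS]exchange_big /=; apply: eq_bigr => b _.
    under eq_bigr do rewrite scaler_sumr.
    rewrite exchange_big /=; apply: eq_bigr => l'' _.
    rewrite [in RHS]mxE scaler_suml; apply: eq_bigr => l' _; exact: scalerA.
  by apply: big1 => l'' _; rewrite meshE mxE scale0r.
rewrite [X in X + _](_ : _ = @corr u x n.+1 l s).
  rewrite corrS subrK; move: lv => /= <-.
  by rewrite mulNmx.
have quoE := tr_quo (@lev_typed u n.+1) (@lev_ind u n.+1).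
transitivity (\sum_m (\sum_b tr (lev u n.+1) (star b) *m quo (lev u n.+1) b) l m
    *: @corr u x n.+1 m s).
  under [RHS]eq_bigr => m _ do rewrite summxE scaler_suml.
  rewrite [RHS]exchange_big /=; apply: eq_bigr => b _.
  under eq_bigr do rewrite scaler_sumr.
  rewrite exchange_big /=; apply: eq_bigr => m _.
  rewrite [in RHS]mxE scaler_suml; apply: eq_bigr => l' _; exact: scalerA.
rewrite quoE (bigD1 l) //= big1 ?addr0 => [|m ml]; rewrite mxE ?eqxx ?scale1r //.
by rewrite eq_sym (negPf ml) scale0r.
Qed.

(** Normal words are their own normal forms. *)
Lemma ext_parent u x n (l : 'I_(hi (lev u n.+1))) s :
  ext u x (parent l).2 ((parent l).1 :: s) = @ext u x n.+1 l s.
Proof.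
rewrite ext_cons [X in _ + X]big1 ?addr0 => [|m _]; last first.
  by rewrite (parent_quo (@lev_ind u n)) scale0r.
rewrite (bigD1 l) //= big1 ?addr0 => [|l' l'l];
  rewrite (parent_tr (@lev_ind u n)) ?eqxx ?scale1r //.
by rewrite eq_sym (negPf l'l) scale0r.
Qed.

Lemma extension_nword u x n (l : 'I_(hi (lev u n))) :
  extension u x (nword l) = A x l.
Proof.
rewrite -ext_nil -[nword l]cats0; elim: n l [::] => [|n IHn] l s.
  by rewrite /extension (ord1 l).
by rewrite /= cat_rcons -ext_parent -IHn.
Qed.

Lemma nword_path u n (l : 'I_(hi (lev u n))) : dpath (up u) (hi_at l) (nword l).
Proof.
elim: n l => [|n IHn] l /=; first exact: eqxx.
rewrite -cats1; apply: dpath_cat (IHn _) _; rewrite /=.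
have := normal_composable l; rewrite /composable => ->; exact: eqxx.
Qed.

(** Any mesh system satisfies the recursion that defines the extension. *)
Lemma mesh_system_unique (Phi : family) : mesh_system Phi ->
  (forall u n (l : 'I_(hi (lev u n))), Phi u (hi_at l) (nword l) = A (hi_at l) l) ->
  forall u x s, dpath (up u) x s -> Phi u x s = extension u x s.
Proof.
move=> Phi_mesh PhiA.
have decomp u x n (l : 'I_(hi (lev u n))) c t : dsrc c = (hi_at l).1 ->
    Phi u x (nword l ++ c :: t) =
      \sum_l' tr (lev u n.+1) c l l' *: Phi u x (@nword u n.+1 l' ++ t) +
      \sum_m quo (lev u n) c l m *: \sum_b \sum_l'
        tr (lev u n) (star b) m l' *: Phi u x (nword l' ++ b :: t).
  move=> cl; pose F (p : darr * 'I_(hi (lev u n))) := Phi u x (nword p.2 ++ p.1 :: t).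
  have cp : composable (c, l) by apply/eqP.
  transitivity (\sum_p ((c, l) == p)%:R *: F p).
    rewrite (bigD1 (c, l)) //= eqxx scale1r big1 ?addr0 // => p.
    by rewrite eq_sym => /negPf->; rewrite scale0r.
  under eq_bigr do rewrite (pair_decomposition (@lev_typed u n) (@lev_ind u n)) // scalerDl.
  rewrite big_split /=; congr (_ + _).
    under eq_bigr do rewrite scaler_suml.
    rewrite exchange_big /=; apply: eq_bigr => l' _.
    rewrite (bigD1 (parent l')) //= eqxx mulr1 big1 ?addr0.
      by rewrite /F cat_rcons.
    by move=> p; rewrite eq_sym => /negPf->; rewrite mulr0 scale0r.
  under eq_bigr do rewrite scaler_suml.
  rewrite exchange_big /=; apply: eq_bigr => m _.
  under eq_bigr do rewrite -scalerA; rewrite -scaler_sumr; congr (_ *: _).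
  by rewrite (pair_bigA _ (fun b l' => tr (lev u n) (star b) m l' *: F (b, l'))) /=;
    apply: eq_bigr; case.
suff PhiE u x n (l : 'I_(hi (lev u n))) s : dpath (hi_at l) x s ->
    Phi u x (nword l ++ s) = ext u x l s.
  by move=> u x s ps; apply: (PhiE u x 0%N ord0 s ps).
have [N] := ubnP (n + size s); elim: N u x n l s => // N IHN.
have corrN u x n (m : 'I_(lo (lev u n))) s : (n + size s <= N)%N ->
    dpath (up (lo_at m)) x s ->
    \sum_b \sum_l' tr (lev u n) (star b) m l' *: Phi u x (nword l' ++ b :: s)
      = corr u x m s.
  elim: n m s => [[]|n IHn m s nN ps] //; rewrite corrS.
  have -> : extension (lo_at m) x s = Phi (lo_at m) x s.
    by apply/esym/(IHN (lo_at m) x 0%N ord0 s) => //; rewrite add0n; lia.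
  have pm := @nword_path u n m.
  rewrite -[A _ _]PhiA -(Phi_mesh u (hi_at m) x _ s pm ps).
  rewrite [X in _ = X - _]big_mkcond -sumrB /=; apply: eq_bigr => b _.
  case: ifP => [/eqP bm|/eqP bm]; last first.
    rewrite !big1 ?subrr // => i _.
      have [->|/quo_neq0[/eqP]] := eqVneq (quo (lev u n) (star b) m i) 0.
        by rewrite scale0r.
      by rewrite dsrc_star.
    have [->|/next_typed[]] := eqVneq (tr (lev u n.+1) (star b) m i) 0.
      by rewrite scale0r.
    by rewrite dsrc_star.
  rewrite decomp ?dsrc_star // -addrA [X in _ + X](_ : _ = 0) ?addr0 //.
  apply/eqP; rewrite subr_eq0; apply/eqP; apply: eq_bigr => m' _.
  have [->|qn] := eqVneq (quo (lev u n) (star b) m m') 0; first by rewrite !scale0r.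
  congr (_ *: _); apply: (IHn m' (b :: s)); first by rewrite /=; lia.
  exact: quo_star_path ps.
move=> u x n l s; elim: s n l => [|b s IHs] n l nN ps.
  by move: ps => /= /eqP <-; rewrite cats0 PhiA.
rewrite decomp; last by case/andP: ps => /eqP.
rewrite ext_cons; congr (_ + _); apply: eq_bigr => i _.
  have [->|tn] := eqVneq (tr (lev u n.+1) b l i) 0; first by rewrite !scale0r.
  congr (_ *: _); apply: IHs; first by move: nN => /=; lia.
  exact: tr_path tn ps.
have [->|qn] := eqVneq (quo (lev u n) b l i) 0; first by rewrite !scale0r.
congr (_ *: _); apply: corrN; first by move: nN => /=; lia.
exact: quo_path qn ps.
Qed.

End Extension.
End MeshSystems.

(** * Modules over the singular Nakajima category *)

Section PathClasses.
Variables (k : fieldType) (Q : quiver).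
Implicit Types x y z : vert Q.

(** Total in s, so that no proof has to be carried along with a list of arrows. *)
Definition word_comb x y (s : seq (arr Q)) : pathcomb k x y :=
  oapp (fun p : qpath x y => << p >>) 0 (insub s).

Lemma word_combE x y s (ps : is_path x y s) :
  word_comb x y s = << (exist _ s ps : qpath x y) >>.
Proof. by rewrite /word_comb (insubT (is_path x y) ps). Qed.

Lemma word_comb_val x y (p : qpath x y) : word_comb x y (val p) = << p >>.
Proof.
by rewrite (word_combE (valP p)); congr << _ >>; apply: val_inj.
Qed.

Lemma pcomp_word x y z s t : is_path x y s -> is_path y z t ->
  pcomp (word_comb y z t) (word_comb x y s) = word_comb x z (s ++ t).
Proof.
move=> ps pt; rewrite (word_combE ps) (word_combE pt).
rewrite (word_combE (is_path_cat ps pt)) /pcomp !linextU.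
by congr << _ >>; apply: val_inj.
Qed.

Lemma linext_word (V : lmodType k) x y s (h : seq (arr Q) -> V) :
  is_path x y s -> linext (fun p : qpath x y => h (val p)) (word_comb x y s) = h s.
Proof. by move=> ps; rewrite (word_combE ps) linextU. Qed.

End PathClasses.

Section Nakajima.
Variables (k : fieldType) (Q : finquiver) (w : zvert Q -> nat).
Local Notation zvert := (zvert Q).
Local Notation ZQ := (repetition (framed Q)).
Local Notation fr := (@frozen_vertex Q).
Local Notation family := (family k w).
Implicit Types (u v x y : zvert) (g : seq (darr Q)) (s t : seq (arr ZQ)).

Definition nonfr x : vert ZQ := (inl x.1, x.2).

Definition out_arrow x : arr ZQ := inl (inr x.1, x.2).
Definition in_arrow u : arr ZQ := inr (inr u.1, u.2 + 1).

Definition arrow_at (b : darr Q) (p : int) : arr ZQ :=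
  match b with inl a => inl (inl a, p) | inr a => inr (inl a, p) end.

Definition lift_arrow (b : darr Q) (x : zvert) : arr ZQ :=
  arrow_at b (step b x).2.

Fixpoint lift x g : seq (arr ZQ) :=
  if g is b :: g' then lift_arrow b x :: lift (step b x) g' else [::].

Lemma lift_path x y g : dpath x y g -> is_path (nonfr x) (nonfr y) (lift x g).
Proof.
elim: g x => [|b g IHg] x /=; first by move/eqP->.
case/andP => /eqP bx /IHg; rewrite /nonfr => pg; apply/andP; split.
  by case: b bx {pg} => a /= ->; rewrite ?addrK.
by case: b bx pg.
Qed.

Lemma lift_cat x y g h : dpath x y g -> lift x (g ++ h) = lift x g ++ lift y h.
Proof.
by elim: g x => [|b g IHg] x /=; [move/eqP-> | case/andP=> _ /IHg->].
Qed.

Lemma lift_mesh v b h : dtgt b = v.1 -> lift v (star b :: b :: h) =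
  sigma (arrow_at b (up v).2) :: arrow_at b (up v).2 :: lift (up v) h.
Proof.
move=> bv; rewrite /= step_star //; congr [:: _, _ & _]; last first.
  by rewrite /lift_arrow step_star.
by case: b bv => a /= _; rewrite /lift_arrow /= ?addrK.
Qed.

Lemma out_arrow_path x : is_path (nonfr x) (fr x) [:: out_arrow x].
Proof. by rewrite /= !eqxx. Qed.

Lemma in_arrow_path u (y : vert ZQ) s : is_path (nonfr (up u)) y s ->
  is_path (fr u) y (in_arrow u :: s).
Proof. by move=> ps; rewrite /= addrK eqxx. Qed.

Lemma arrows_from_fr u (c : arr ZQ) : src c = fr u -> c = in_arrow u.
Proof.
case: u => j q; case: c => -[[a|i] p] //= [] //.
by move=> -> Dq; rewrite -Dq /in_arrow /= subrK.
Qed.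

Lemma arrows_from_nonfr x (c : arr ZQ) : src c = nonfr x ->
  c = out_arrow x \/ exists b, [/\ dsrc b = x.1, c = lift_arrow b x &
    tgt c = nonfr (step b x)].
Proof.
case: x => i p; case: c => -[[a|j] q] //= [<- Dq].
- by right; exists (inl a); rewrite -Dq.
- by left; rewrite -Dq.
- right; exists (inr a); rewrite /lift_arrow /nonfr /= -Dq subrK; split=> //.
Qed.

Lemma sum_arrows_into (V : zmodType) (F : arr ZQ -> V) x :
  \sum_(c <- arrows_into (nonfr x)) F c =
    \sum_(b : darr Q | dtgt b == x.1) F (arrow_at b x.2) + F (inr (inr x.1, x.2)).
Proof.
rewrite big_cat !big_map !big_filter !big_enum_cond /= !big_sumType /=.
rewrite [X in _ + X + _]big_pred0 // addr0 -addrA; congr (_ + (_ + _)).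
by rewrite (big_pred1 x.1) // => i.
Qed.

Section Evaluation.
Variable Phi : family.

(** Reads a path from left to right.  The state [Some g] means that the path has
    left the frozen vertex u and has followed g since, and [None] that it is at
    u.  At the end u and v are equal, and [pid_mx] is then the identity. *)
Fixpoint ev v u (o : option (seq (darr Q))) t : 'M[k]_(w v, w u) :=
  match t, o with
  | [::], None => pid_mx (w v)
  | [::], Some _ => 0
  | _ :: t', None => ev v u (Some [::]) t'
  | inl (inl a, _) :: t', Some g => ev v u (Some (rcons g (inl a))) t'
  | inr (inl a, _) :: t', Some g => ev v u (Some (rcons g (inr a))) t'
  | inl (inr i, p) :: t', Some g => ev v (i, p) None t' *m Phi u (i, p) g
  | inr (inr _, _) :: _, Some _ => 0
  end.

Lemma ev_arrow v u g b p t :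
  ev v u (Some g) (arrow_at b p :: t) = ev v u (Some (rcons g b)) t.
Proof. by case: b. Qed.

Lemma ev_out v u g x t :
  ev v u (Some g) (out_arrow x :: t) = ev v x None t *m Phi u x g.
Proof. by case: x. Qed.

Lemma ev_lift v u g x h t :
  ev v u (Some g) (lift x h ++ t) = ev v u (Some (g ++ h)) t.
Proof.
elim: h x g => [|b h IHh] x g; first by rewrite cats0.
rewrite -[lift x _]/(arrow_at b (step b x).2 :: lift (step b x) h) cat_cons.
by rewrite ev_arrow IHh cat_rcons.
Qed.

Definition reaches u (o : option (seq (darr Q))) (x0 : vert ZQ) : Prop :=
  if o is Some g then exists2 x, x0 = nonfr x & dpath (up u) x g else x0 = fr u.

Lemma reaches_step u o (x0 : vert ZQ) c t (y : vert ZQ) : reaches u o x0 -> is_path x0 y (c :: t) ->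
  (exists o', reaches u o' (tgt c) /\ forall v t', ev v u o (c :: t') = ev v u o' t')
  \/ exists g x, [/\ o = Some g, c = out_arrow x, x0 = nonfr x & dpath (up u) x g].
Proof.
case: o => [g [x -> pg]|->]; rewrite [is_path _ _ _]/= => /andP[/eqP cx _].
  case: (arrows_from_nonfr cx) => [->|[b [bx Dc ->]]]; last first.
    rewrite Dc; left; exists (Some (rcons g b)); split; last first.
      by move=> ? ?; rewrite /lift_arrow ev_arrow.
    exists (step b x) => //; rewrite -cats1; apply: dpath_cat pg _.
    by rewrite /= bx !eqxx.
  by right; exists g, x.
left; rewrite (arrows_from_fr cx); exists (Some [::]); split=> //.
by exists (up u) => //=; apply: eqxx.
Qed.

(** The part of the path before the last frozen vertex u' contributes a right
    factor X; the rest g is still to be completed. *)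
Lemma ev_to_nonfr s u o (x0 : vert ZQ) y : reaches u o x0 -> is_path x0 (nonfr y) s ->
  exists u' g (X : 'M[k]_(w u', w u)), dpath (up u') y g /\
    forall v t, ev v u o (s ++ t) = ev v u' (Some g) t *m X.
Proof.
elim: s u o x0 => [|c s IHs] u o x0 ro.
  move=> /= /eqP xy; case: o ro => [g [x Dx pg]|Dx]; last by rewrite Dx in xy.
  exists u, g, 1%:M; split; last by move=> v t; rewrite mulmx1.
  by move: Dx pg; rewrite xy; case: (x) (y) => ? ? [? ?] [<- <-].
move=> pcs; have [[o' [ro' oE]]|[g [x [-> Dc Dx pg]]]] := reaches_step ro pcs.
  have [u' [g [X [pg evX]]]] := IHs u o' (tgt c) ro' (proj2 (andP pcs)).
  by exists u', g, X; split=> // v t; rewrite cat_cons oE evX.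
have ps : is_path (fr x) (nonfr y) s by case/andP: pcs => _; rewrite Dc.
have [u' [g' [X [pg' evX]]]] := IHs x None (fr x) erefl ps.
exists u', g', (X *m Phi u x g); split=> // v t.
by rewrite Dc cat_cons ev_out evX mulmxA.
Qed.

Lemma ev_from_nonfr t y v : is_path (nonfr y) (fr v) t ->
  exists x g (Y : 'M[k]_(w v, w x)), dpath y x g /\
    forall u g', ev v u (Some g') t = Y *m Phi u x (g' ++ g).
Proof.
elim: t y => [|c t IHt] y; first by [].
case/andP => /eqP cy pt.
case: (arrows_from_nonfr cy) pt => [->|[b [bx Dc ->]]] pt.
  exists y, [::], (ev v y None t); split=> [|u g']; first exact: eqxx.
  by rewrite -ev_out cats0.
have [x [g [Y [pg evY]]]] := IHt _ pt; rewrite Dc.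
exists x, (b :: g), Y; split=> [|u g']; first by rewrite /= bx eqxx.
by rewrite /lift_arrow ev_arrow evY cat_rcons.
Qed.

Lemma ev_cat s u o (x0 : vert ZQ) v u' t : reaches u o x0 ->
  is_path x0 (fr u') s -> ev v u o (s ++ t) = ev v u' None t *m ev u' u o s.
Proof.
elim: s u o x0 => [|c s IHs] u o x0 ro.
  move=> /= /eqP xu'; case: o ro => [g [x Dx _]|Dx]; first by rewrite Dx in xu'.
  have -> : u = u' by move: Dx; rewrite xu'; case: (u) (u') => ? ? [? ?] [<- <-].
  by rewrite pid_mx_1 mulmx1.
move=> pcs; case: (reaches_step ro pcs) => [[o' [ro' oE]]|[g [x [-> Dc Dx pg]]]].
  by rewrite cat_cons !oE (IHs _ _ _ ro') //; case/andP: pcs.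
rewrite Dc cat_cons !ev_out mulmxA (IHs x None (fr x)) //.
by case/andP: pcs; rewrite Dc.
Qed.

Hypothesis Phi_mesh : mesh_system Phi.

Lemma linext_swap (K L : choiceType) (V : lmodType k) (F : K -> L -> V)
    (f : {malg k[K]}) (g : {malg k[L]}) :
  linext (fun p => linext (F p) g) f = linext (fun q => linext (F^~ q) f) g.
Proof.
rewrite /linext; under eq_bigr do rewrite scaler_sumr.
rewrite exchange_big /=; apply: eq_bigr => q _; rewrite scaler_sumr.
by apply: eq_bigr => p _; rewrite !scalerA mulrC.
Qed.

Lemma linext_pcomp (V : lmodType k) (P : quiver) (x y z : vert P)
    (h : qpath x z -> V) (g : pathcomb k y z) (f : pathcomb k x y) :
  linext h (pcomp g f) = linext (fun p => linext (fun q => h (cat_path p q)) g) f.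
Proof.
rewrite linext_linext; apply: eq_linext => p; rewrite linext_linext.
by apply: eq_linext => q; rewrite linextU.
Qed.

Lemma linext0 (K : choiceType) (V : lmodType k) (h : K -> V) (f : {malg k[K]}) :
  (forall p, h p = 0) -> linext h f = 0.
Proof. by move=> h0; apply: big1 => p _; rewrite h0 scaler0. Qed.

Lemma ev_mesh_relator x u v s t :
  is_path (fr u) (tau (nonfr x)) s -> is_path (nonfr x) (fr v) t ->
  linext (fun p : qpath (tau (nonfr x)) (nonfr x) => ev v u None (s ++ val p ++ t))
    (mesh_relator k (nonfr x)) = 0.
Proof.
pose x' : zvert := (x.1, x.2 - 1).
have Dx : up x' = x by rewrite /up /= subrK; case: (x).
move=> ps pt; have {ps}ps : is_path (fr u) (nonfr x') s by [].
have [u' [g [X [pg evX]]]] := @ev_to_nonfr s u None (fr u) x' erefl ps.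
have [z [g' [Y [pg' evY]]]] := ev_from_nonfr pt.
rewrite /mesh_relator raddf_sum big_seq.
transitivity (\sum_(c <- arrows_into (nonfr x))
    ev v u None (s ++ [:: sigma c, c & t])).
  rewrite [RHS]big_seq; apply: eq_bigr => c; rewrite mem_arrows_into => /eqP cx.
  exact: (linext_word (fun r => ev v u None (s ++ r ++ t)) (mesh_path cx)).
rewrite sum_arrows_into evX.
have -> : [:: sigma (inr (inr x.1, x.2) : arr ZQ), inr (inr x.1, x.2) & t]
    = out_arrow x' :: (inr (inr x.1, x.2) : arr ZQ) :: t by [].
rewrite ev_out [ev _ _ None _]evY.
transitivity ((\sum_(b : darr Q | dtgt b == x'.1)
    Y *m Phi u' z (g ++ star b :: b :: g') + Y *m Phi x' z g' *m Phi u' x' g) *m X).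
  rewrite mulmxDl mulmx_suml; congr (_ + _); apply: eq_bigr => b /eqP bx.
  rewrite evX; congr (_ *m X).
  have -> : [:: sigma (arrow_at b x.2), arrow_at b x.2 & t]
      = lift x' [:: star b; b] ++ t by rewrite lift_mesh // Dx.
  by rewrite ev_lift evY -catA.
rewrite -mulmx_sumr Phi_mesh ?Dx //.
by rewrite mulmxN mulmxA addNr mul0mx.
Qed.

(** Paths s and t around an element of the ideal reduce the claim to a single
    mesh relator, which [ev_mesh_relator] handles by the mesh system identity. *)
Lemma ev_ideal (x y : vert ZQ) (f : pathcomb k x y) :
  ideal (@mesh_relation k Q) f -> forall u v s t,
  is_path (fr u) x s -> is_path y (fr v) t ->
  linext (fun p : qpath x y => ev v u None (s ++ val p ++ t)) f = 0.
Proof.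
elim=> {x y f}.
- move=> _ _ _ [[[i|i] p] // _] u v s t; exact: (@ev_mesh_relator (i, p)).
- by move=> x y u v s t _ _; rewrite raddf0.
- move=> x y c f g _ IHf _ IHg u v s t ps pt.
  by rewrite linearP /= IHf // IHg // scaler0 addr0.
- move=> x y z g f _ IHf u v s t ps pt.
  rewrite linext_pcomp linext_swap; apply: linext0 => q.
  rewrite -[RHS](IHf u v s (val q ++ t) ps (is_path_cat (valP q) pt)).
  by apply: eq_linext => p; rewrite /= -!catA.
move=> x y z g f _ IHg u v s t ps pt.
rewrite linext_pcomp; apply: linext0 => p.
rewrite -[RHS](IHg u v (s ++ val p) t (is_path_cat ps (valP p)) pt).
by apply: eq_linext => q; rewrite /= -!catA.
Qed.

Notation S := (singular_nakajima k Q).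

Definition act_fun (u v : S) (f : hom u v) : 'M[k]_(w v, w u) :=
  linext (fun p : qpath (fr u) (fr v) => ev v u None (val p)) (qrepr f).

Lemma act_funE (u v : zvert) (f : pathcomb k (fr u) (fr v)) :
  @act_fun u v (qclass (@mesh_relation k Q) f) =
  linext (fun p : qpath (fr u) (fr v) => ev v u None (val p)) f.
Proof.
apply/eqP; rewrite -subr_eq0 -raddfB; apply/eqP.
rewrite -[RHS](@ev_ideal _ _ _ (qreprE (@mesh_relation k Q) f) u v [::] [::]
  (eqxx _) (eqxx _)).
by apply: eq_linext => p; rewrite /= cats0.
Qed.

Lemma act_fun_linear (u v : S) : linear (@act_fun u v).
Proof.
move=> c f g; rewrite -[f](qreprK f) -[g](qreprK g).
by rewrite -qclass_is_linear !act_funE linearP.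
Qed.

Lemma act_fun_id (u : S) : act_fun (idm u) = 1%:M.
Proof. by rewrite [LHS]act_funE linextU /= pid_mx_1. Qed.

Lemma act_fun_comp (u1 u2 u3 : S) (g : hom u2 u3) (f : hom u1 u2) :
  act_fun (comp g f) = act_fun g *m act_fun f.
Proof.
rewrite -[f](qreprK f) -[g](qreprK g).
rewrite -[comp _ _]/(qcomp _ _) qcompE !act_funE linext_pcomp.
rewrite [in RHS]/linext mulmx_suml [LHS]linext_swap; apply: eq_bigr => q _.
rewrite -scalemxAl; congr (_ *: _); rewrite /linext mulmx_sumr.
apply: eq_bigr => p _; rewrite -scalemxAr; congr (_ *: _).
by rewrite (@ev_cat (val p) u1 None (fr u1) _ u2) // (valP p).
Qed.

Definition act_linear (u v : S) : {linear hom u v -> 'M[k]_(w v, w u)} :=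
  HB.pack (@act_fun u v) (GRing.isLinear.Build k (hom u v) 'M[k]_(w v, w u)
    *:%R (@act_fun u v) (@act_fun_linear u v)).

Definition module_of : @matrix_module k S w :=
  @MatrixModule k S w act_linear act_fun_id act_fun_comp.

End Evaluation.
End Nakajima.

Section FamilyOfModule.
Variables (k : fieldType) (Q : finquiver) (w : zvert Q -> nat).
Local Notation zvert := (zvert Q).
Local Notation ZQ := (repetition (framed Q)).
Local Notation fr := (@frozen_vertex Q).
Local Notation rel := (@mesh_relation k Q).
Local Notation S := (singular_nakajima k Q).
Implicit Types (u v x y : zvert) (g : seq (darr Q)) (s t : seq (arr ZQ)).

Definition loop_word u x g : seq (arr ZQ) :=
  in_arrow u :: lift (up u) g ++ [:: out_arrow x].

Lemma loop_path u x g : dpath (up u) x g -> is_path (fr u) (fr x) (loop_word u x g).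
Proof.
move=> pg; apply/in_arrow_path/(is_path_cat (lift_path pg)); exact: out_arrow_path.
Qed.

Definition path_class u v s : @hom k S u v :=
  qclass rel (word_comb k (fr u) (fr v) s).

Lemma path_class_cat u v x s t :
  is_path (fr u) (fr v) s -> is_path (fr v) (fr x) t ->
  path_class u x (s ++ t) = @comp k S u v x (path_class v x t) (path_class u v s).
Proof.
by move=> ps pt; rewrite -[RHS]/(qcomp _ _) qcompE pcomp_word.
Qed.

Lemma pcomp_suml (P : quiver) (x y z : vert P) (I : Type) (r : seq I)
    (F : I -> pathcomb k y z) (f : pathcomb k x y) :
  pcomp (\sum_(i <- r) F i) f = \sum_(i <- r) pcomp (F i) f.
Proof.
have D (g h : pathcomb k y z) : pcomp (g + h) f = pcomp g f + pcomp h f.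
  by rewrite -{1}[g]scale1r pcomp_linearl scale1r.
have Z : pcomp (0 : pathcomb k y z) f = 0.
  by rewrite -[0 in LHS](subrr 0) pcompBl subrr.
exact: (big_morph (fun g : pathcomb k y z => pcomp g f) D Z).
Qed.

Lemma pcomp_sumr (P : quiver) (x y z : vert P) (I : Type) (r : seq I)
    (g : pathcomb k y z) (F : I -> pathcomb k x y) :
  pcomp g (\sum_(i <- r) F i) = \sum_(i <- r) pcomp g (F i).
Proof.
have D (f h : pathcomb k x y) : pcomp g (f + h) = pcomp g f + pcomp g h.
  by rewrite -{1}[f]scale1r pcomp_linearr scale1r.
have Z : pcomp g (0 : pathcomb k x y) = 0.
  by rewrite -[0 in LHS](subrr 0) pcompBr subrr.
exact: (big_morph (fun f : pathcomb k x y => pcomp g f) D Z).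
Qed.

Lemma qclass_sum (x y : vert ZQ) (I : Type) (r : seq I) (P : pred I)
    (F : I -> pathcomb k x y) :
  qclass rel (\sum_(i <- r | P i) F i) = \sum_(i <- r | P i) qclass rel (F i).
Proof.
apply: (big_morph (@qclass k _ rel x y)) => [f h|]; first exact: qclassD.
by apply: (addrI (qclass rel 0)); rewrite -qclassD !addr0.
Qed.

(** In the regular Nakajima category, the mesh relator at [up v], composed on both
    sides, vanishes; its term through the frozen vertex v is the composition. *)
Lemma class_mesh u v x g h : dpath (up u) v g -> dpath (up v) x h ->
  \sum_(b : darr Q | dtgt b == v.1)
      path_class u x (loop_word u x (g ++ star b :: b :: h)) =
    - @comp k S u v x (path_class v x (loop_word v x h))
                      (path_class u v (loop_word u v g)).
Proof.
move=> pg ph; apply/eqP; rewrite -subr_eq0 opprK; apply/eqP.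
rewrite -path_class_cat ?loop_path //.
pose y := nonfr (up v); pose s := in_arrow u :: lift (up u) g.
pose t := lift (up v) h ++ [:: out_arrow x].
have ps : is_path (fr u) (tau y) s.
  by apply: in_arrow_path; rewrite /tau /y /= addrK; apply: lift_path.
have pt : is_path y (fr x) t.
  exact: is_path_cat (lift_path ph) (out_arrow_path x).
transitivity (qclass rel (\sum_(c <- arrows_into y)
    word_comb k (fr u) (fr x) (s ++ [:: sigma c; c] ++ t))).
  rewrite sum_arrows_into qclassD qclass_sum; congr (_ + _).
    apply: eq_bigr => b /eqP bv; rewrite /path_class /loop_word.
    by rewrite (lift_cat _ pg) lift_mesh // -!catA.
  rewrite /path_class /loop_word /= -!catA /=.
  by rewrite /out_arrow /in_arrow /= addrK.
have -> : 0 = qclass rel (0 : pathcomb k (fr u) (fr x)).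
  by apply: (addrI (qclass rel 0)); rewrite -qclassD !addr0.
apply/qclass_eq; rewrite subr0.
suff -> : \sum_(c <- arrows_into y) word_comb k (fr u) (fr x) (s ++ [:: sigma c; c] ++ t)
    = pcomp (word_comb k y (fr x) t) (pcomp (mesh_relator k y) (word_comb k (fr u) (tau y) s)).
  by apply/ideal_compl/ideal_compr/ideal_rel; apply: MeshRelation.
rewrite pcomp_suml pcomp_sumr big_seq [RHS]big_seq; apply: eq_bigr => c.
rewrite mem_arrows_into => /eqP cy; have pc := mesh_path cy.
rewrite -[oapp _ _ _]/(word_comb k (tau y) y _).
by rewrite (pcomp_word _ ps pc) pcomp_word -?catA //; apply: is_path_cat ps pc.
Qed.

Definition family_of (M : @matrix_module k S w) : family k w :=
  fun u x g => act M u x (path_class u x (loop_word u x g)).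

Lemma family_of_mesh M : mesh_system (family_of M).
Proof.
move=> u v x g h pg ph; rewrite /family_of -raddf_sum class_mesh //.
by rewrite raddfN -act_comp.
Qed.

(** The path is cut at the frozen vertices, and M is multiplicative there. *)
Lemma act_ev (M : @matrix_module k S w) (Phi : family k w) :
  (forall u x g, dpath (up u) x g -> family_of M u x g = Phi u x g) ->
  forall v t,
  (forall u g y, dpath (up u) y g -> is_path (nonfr y) (fr v) t ->
     act M u v (path_class u v (in_arrow u :: lift (up u) g ++ t)) =
       ev Phi v u (Some g) t) /\
  (forall u, is_path (fr u) (fr v) t -> act M u v (path_class u v t) = ev Phi v u None t).
Proof.
move=> MPhi v; elim=> [|c t [IHs IHn]].
  split=> [//|u /= /eqP uv].
  have -> : u = v by case: uv; case: (u) (v) => ? ? [? ?] /= -> ->.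
  rewrite pid_mx_1 -(act_id M v); congr (act M v v _); congr qclass.
  have p0 : is_path (fr v) (fr v) [::] by apply: eqxx.
  by rewrite (word_combE k p0); congr << _ >>; apply: val_inj.
split=> [u g y pg|u /andP[/eqP cu]].
  case/andP=> /eqP cy; case: (arrows_from_nonfr cy) => [->|[b [bx Dc ->]]] pt.
    rewrite ev_out -IHn // -MPhi // -[family_of M u y g]/(act M u y _) -act_comp.
    rewrite -path_class_cat ?loop_path //; congr (act M u v (path_class u v _)).
    by rewrite /loop_word /= -catA.
  rewrite Dc /lift_arrow ev_arrow -(IHs u _ (step b y)) //; last first.
    by rewrite -cats1; apply: dpath_cat pg _; rewrite /= bx !eqxx.
  by rewrite -cats1 (lift_cat _ pg) /= -catA.
move: cu => /arrows_from_fr Dc; rewrite Dc => pt.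
rewrite -[ev _ _ _ _ _]/(ev Phi v u (Some [::]) t) -(IHs u [::] (up u)) //.
  exact: eqxx.
Qed.

Lemma act_linext (M : @matrix_module k S w) (Phi : family k w) :
  (forall u x g, dpath (up u) x g -> family_of M u x g = Phi u x g) ->
  forall u v (f : @hom k S u v), act M u v f =
    linext (fun p : qpath (fr u) (fr v) => ev Phi v u None (val p)) (qrepr f).
Proof.
move=> MPhi u v f; have Df := qreprK f.
rewrite -{1}Df -[X in qclass _ X]linext_id /linext qclass_sum raddf_sum.
apply: eq_bigr => p _.
have Ep : qclass rel ((qrepr f)@_p *: << p >>)
    = qscale (qrepr f)@_p (path_class u v (val p)).
  by rewrite qscaleE word_comb_val.
rewrite Ep [LHS](linearZ_LR (act M u v)); congr (_ *: _).
by have [_ ->] := act_ev MPhi v (val p); rewrite ?(valP p).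
Qed.

Lemma module_eq (M M' : @matrix_module k S w) :
  (forall u x g, dpath (up u) x g -> family_of M u x g = family_of M' u x g) ->
  M = M'.
Proof.
move=> MM'; apply: matrix_coord_inj; apply: funext => -[[u v] [f [i j]]].
rewrite /matrix_coord /= (act_linext MM') (act_linext (Phi := family_of M')) //.
Qed.

Lemma family_of_module_of (Phi : family k w) (Phi_mesh : mesh_system Phi) u x g :
  dpath (up u) x g -> family_of (module_of Phi_mesh) u x g = Phi u x g.
Proof.
move=> pg; rewrite /family_of [LHS](act_funE Phi_mesh).
rewrite (linext_word (fun t => ev Phi x u None t) (loop_path pg)).
rewrite /loop_word -[LHS]/(ev Phi x u (Some [::]) _) ev_lift ev_out /= pid_mx_1.
by rewrite mul1mx.
Qed.

End FamilyOfModule.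

(** * Affine coordinates *)

From mathcomp Require Import mpoly.

Section Bound.
Variable Q : finquiver.
Hypothesis Qacyclic : acyclic Q.
Local Notation zvert := (zvert Q).

Let edge : rel (fvert Q) := fun i j => [exists a, (fsrc a == i) && (ftgt a == j)].

Definition ancestors (i : fvert Q) : nat := #|[set j | connect edge j i]|.

Lemma connect_path i j : connect edge i j ->
  exists s : seq (farr Q), @is_path Q i j s.
Proof.
case/connectP => p pe ->; elim: p i pe => [|j' p IHp] i /=.
  by exists [::]; apply: eqxx.
case/andP => /existsP[a /andP[/eqP ai /eqP aj]] /IHp[s ps].
by exists (a :: s); rewrite /= ai eqxx aj.
Qed.

Lemma ancestors_lt (a : farr Q) : (ancestors (fsrc a) < ancestors (ftgt a))%N.
Proof.
have ea : edge (fsrc a) (ftgt a) by apply/existsP; exists a; rewrite !eqxx.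
apply/proper_card/properP; split.
  by apply/subsetP => j; rewrite !inE => /connect_trans; apply; apply: connect1.
exists (ftgt a); rewrite !inE ?connect0 //; apply/negP => /connect_path[s ps].
by have /Qacyclic : @is_path Q (fsrc a) (fsrc a) (a :: s) by rewrite /= eqxx.
Qed.

Let bound := #|fvert Q|.

Lemma ancestors_le i : (ancestors i <= bound)%N.
Proof. exact: max_card. Qed.

(** Strictly increasing along the arrows: an arrow of Q gains an ancestor by
    acyclicity, and an arrow to the next copy of Q loses at most as many
    ancestors as there are vertices. *)
Definition height (x : zvert) : int :=
  x.2 * bound.+1%:Z + (ancestors x.1)%:Z.

Lemma height_step b (x : zvert) : dsrc b = x.1 -> height x + 1 <= height (step b x).
Proof.
case: x => i p; case: b => a /= <-; rewrite /height /=.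
  by rewrite -!addrA lerD2l; have := ancestors_lt a; lia.
have := ancestors_le (ftgt a).
by rewrite mulrDl mul1r -!addrA lerD2l; lia.
Qed.

Lemma height_path (x y : zvert) s : dpath x y s -> (size s)%:Z <= height y - height x.
Proof.
elim: s x => [|b s IHs] x /=; first by move/eqP->; rewrite subrr.
by case/andP=> /eqP/height_step bx /IHs; lia.
Qed.

Lemma length_bound (D : seq zvert) : exists N, forall u x s,
  u \in D -> x \in D -> dpath (up u) x s -> (size s < N)%N.
Proof.
exists (\max_(u <- D) \max_(x <- D) `|height x - height (up u)|%N).+1.
move=> u x s uD xD ps; rewrite ltnS.
apply: (@leq_trans `|height x - height (up u)|%N).
  by have := height_path ps; lia.
apply: leq_trans (@leq_bigmax_seq _ _ xpredT
  (fun u => \max_(x <- D) `|height x - height (up u)|%N) _ uD isT).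
exact: (@leq_bigmax_seq _ _ xpredT (fun x => `|height x - height (up u)|%N) _ xD).
Qed.

End Bound.

Section PolynomialFunctions.
Variables (k : fieldType) (n : nat).

Definition polyfun (F : 'rV[k]_n -> k) : Prop :=
  exists P : mpoly n k, forall c, F c = P.@[fun j => c 0 j].

Definition polymx p q (F : 'rV[k]_n -> 'M[k]_(p, q)) : Prop :=
  forall i j, polyfun (fun c => F c i j).

Lemma polyfun_cst a : polyfun (fun=> a).
Proof. by exists a%:MP_[n] => c; rewrite mevalC. Qed.

Lemma polyfun_var j : polyfun (fun c => c 0 j).
Proof. by exists 'X_j => c; rewrite mevalXU. Qed.

Lemma polyfunD F G : polyfun F -> polyfun G -> polyfun (fun c => F c + G c).
Proof.
by case=> P FP [R GR]; exists (P + R) => c; rewrite mevalD FP GR.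
Qed.

Lemma polyfunM F G : polyfun F -> polyfun G -> polyfun (fun c => F c * G c).
Proof.
by case=> P FP [R GR]; exists (P * R) => c; rewrite mevalM FP GR.
Qed.

Lemma polyfun_sum I (r : seq I) (F : I -> 'rV[k]_n -> k) :
  (forall i, polyfun (F i)) -> polyfun (fun c => \sum_(i <- r) F i c).
Proof.
move=> FP; elim: r => [|i r IHr].
  by have [P EP] := polyfun_cst 0; exists P => c; rewrite big_nil -EP.
by have [P EP] := polyfunD (FP i) IHr; exists P => c; rewrite big_cons -EP.
Qed.

Lemma polyfun_ext F G : F =1 G -> polyfun F -> polyfun G.
Proof. by move=> FG [P FP]; exists P => c; rewrite -FG. Qed.

Lemma polymx_cst p q (A : 'M[k]_(p, q)) : polymx (fun=> A).
Proof. by move=> i j; apply: polyfun_cst. Qed.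

Lemma polymx_sum p q I (r : seq I) (F : I -> 'rV[k]_n -> 'M[k]_(p, q)) :
  (forall i, polymx (F i)) -> polymx (fun c => \sum_(i <- r) F i c).
Proof.
move=> FP i j; apply: (@polyfun_ext (fun c => \sum_(x <- r) F x c i j)).
  by move=> c; rewrite summxE.
by apply: polyfun_sum => x; apply: FP.
Qed.

Lemma polymxZ p q a (F : 'rV[k]_n -> 'M[k]_(p, q)) :
  polymx F -> polymx (fun c => a *: F c).
Proof.
move=> FP i j; apply: (@polyfun_ext (fun c => a * F c i j)).
  by move=> c; rewrite mxE.
by apply: polyfunM; [apply: polyfun_cst | apply: FP].
Qed.

Lemma polymxD p q (F G : 'rV[k]_n -> 'M[k]_(p, q)) :
  polymx F -> polymx G -> polymx (fun c => F c + G c).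
Proof.
move=> FP GP i j; apply: (@polyfun_ext (fun c => F c i j + G c i j)).
  by move=> c; rewrite mxE.
by apply: polyfunD; [apply: FP | apply: GP].
Qed.

Lemma polymxN p q (F : 'rV[k]_n -> 'M[k]_(p, q)) :
  polymx F -> polymx (fun c => - F c).
Proof.
move=> FP i j; apply: (@polyfun_ext (fun c => -1 * F c i j)).
  by move=> c; rewrite mxE mulN1r.
by apply: polyfunM; [apply: polyfun_cst | apply: FP].
Qed.

Lemma polymxM p q r (F : 'rV[k]_n -> 'M[k]_(p, q)) (G : 'rV[k]_n -> 'M[k]_(q, r)) :
  polymx F -> polymx G -> polymx (fun c => F c *m G c).
Proof.
move=> FP GP i j; apply: (@polyfun_ext (fun c => \sum_l F c i l * G c l j)).
  by move=> c; rewrite mxE.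
by apply: polyfun_sum => l; apply: polyfunM; [apply: FP | apply: GP].
Qed.

End PolynomialFunctions.

Section PolynomialExtension.
Variables (k : fieldType) (Q : finquiver) (w : zvert Q -> nat) (N : nat).
Local Notation lev := (@levels k Q).
Variable A : 'rV[k]_N -> forall u x n, 'I_(hi (lev u n)) -> 'M[k]_(w x, w u).
Hypothesis A_poly : forall u x n l, polymx (fun c => @A c u x n l).

Lemma corr_rec_poly u x Phi n (m : 'I_(lo (lev u n))) s :
  (forall v t, polymx (fun c => Phi c v t)) ->
  polymx (fun c => @corr_rec k Q w (A c) u x (Phi c) n m s).
Proof.
move=> PhiP; elim: n m s => [|n IHn] m s /=; first exact: polymx_cst.
apply: polymxD; first by apply: polymxN; apply: polymxM.
apply: polymxN; apply: polymx_sum => b; apply: polymx_sum => m'.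
by apply: polymxZ; apply: IHn.
Qed.

Lemma ext_rec_poly K u x s n (l : 'I_(hi (lev u n))) :
  polymx (fun c => @ext_rec k Q w (A c) K u x s n l).
Proof.
elim: K u x s n l => [|K IHK] u x s n l; first exact: polymx_cst.
elim: s n l => [|b s IHs] n l; first exact: A_poly.
apply: polymxD; apply: polymx_sum => i; apply: polymxZ; first exact: (IHs n.+1).
by apply: corr_rec_poly => v t; apply: IHK.
Qed.

Lemma ev_poly v u o t :
  polymx (fun c => ev (extension (A c)) v u o t).
Proof.
elim: t u o => [|[[[a|i] p]|[[a|i] p]] t IHt] u [g|] /=; try exact: IHt;
  try exact: polymx_cst.
by apply: polymxM => //; apply: ext_rec_poly.
Qed.

End PolynomialExtension.

Section Isomorphism.
Variables (k : fieldType) (Q : finquiver) (w : dimvec Q).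
Hypothesis Qacyclic : acyclic Q.
Local Notation lev := (@levels k Q).
Local Notation zvert := (zvert Q).
Hypothesis levP : forall u n, typed (lev u n) /\ independent (lev u n).

Let wf : zvert -> nat := fun u => w u.

Section Coordinates.
Variable N : nat.
Hypothesis NP : forall u x s, u \in finsupp w -> x \in finsupp w ->
  dpath (up u) x s -> (size s < N)%N.

(** One coordinate for each entry of the matrix prescribed on each normal word
    between two vertices in the support of w. *)
Definition param : finType :=
  {u : finsupp w & {x : finsupp w & {n : 'I_N &
    {lij : 'I_(hi (lev (val u) n)) * 'I_(w (val x)) * 'I_(w (val u))
      | hi_at lij.1.1 == val x }}}}.

(** The same data without dependent types, so that an index can be looked up
    without transporting ordinals between equal bounds. *)
Definition code (i : param) : zvert * zvert * nat * nat * nat * nat :=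
  let: existT u (existT x (existT n (exist (l, i, j) _))) := i in
  (val u, val x, val n, val l, val i, val j).

Lemma code_inj : injective code.
Proof.
case=> u [x [n [[[l i] j] p]]] [u' [x' [n' [[[l' i'] j'] p']]]] /=.
case=> /val_inj eu /val_inj ex /val_inj en.
case: u' / eu l' i' j' p' => l' i' j' p'.
case: x' / ex i' p' => i' p'.
case: n' / en l' p' => l' p' /val_inj el /val_inj ei /val_inj ej.
move: p'; rewrite -el -ei -ej => p'.
by rewrite (eq_irrelevance p p').
Qed.

(** An entry without a coordinate is set to 0; then l does not end at x. *)
Definition assignment (c : 'rV[k]_#|param|) u x n (l : 'I_(hi (lev u n))) :
    'M[k]_(wf x, wf u) :=
  \matrix_(i, j) if [pick r | code r == (u, x, n, val l, val i, val j)] is Some r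
    then c 0 (enum_rank r) else 0.

Definition param_value (Phi : family k wf) (r : param) : k :=
  let: existT u (existT x (existT n (exist (l, i, j) _))) := r in
  Phi (val u) (val x) (nword l) i j.

Definition param_row (Phi : family k wf) : 'rV[k]_#|param| :=
  \row_r param_value Phi (enum_val r).

(** A matrix with an entry joins two vertices of the support, and its normal word is
    shorter than N, so every entry is found among the coordinates. *)
Lemma assignment_row (Phi : family k wf) u n (l : 'I_(hi (lev u n))) :
  assignment (param_row Phi) (hi_at l) l = Phi u (hi_at l) (nword l).
Proof.
apply/matrixP => i j; rewrite mxE.
have xS : hi_at l \in finsupp w.
  by rewrite mem_finsupp -lt0n; apply: leq_trans (ltn_ord i).
have uS : u \in finsupp w.
  by rewrite mem_finsupp -lt0n; apply: leq_trans (ltn_ord j).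
have sz : size (nword l) = n.
  by elim: n l {i xS} => //= n IHn l; rewrite size_rcons IHn.
have nN : (n < N)%N by rewrite -sz; apply: NP (nword_path l).
pose r : param := existT _ [` uS]%fset (existT _ [` xS]%fset (existT _ (Ordinal nN)
  (exist _ (l, i, j) (eqxx _)))).
case: pickP => [r' /eqP Dr'|/(_ r)]; last by rewrite eqxx.
have {Dr'}-> : r' = r by apply: code_inj.
by rewrite mxE enum_rankK.
Qed.

Lemma param_row_extension c : param_row (extension (assignment c)) = c.
Proof.
apply/rowP => r; rewrite mxE -[in RHS](enum_valK r).
case: (enum_val r) => u [x [n [[[l i] j] p]]] /=.
rewrite extension_nword // mxE; case: pickP => [r' /eqP Dr'|].
  by congr (c 0 (enum_rank _)); apply: code_inj.
move/(_ (existT _ u (existT _ x (existT _ n (exist _ (l, i, j) p))))).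
by rewrite /= eqxx.
Qed.

Lemma assignment_poly u x n l : polymx (fun c => @assignment c u x n l).
Proof.
move=> i j; pose o := [pick r | code r == (u, x, n, val l, val i, val j)].
apply: (@polyfun_ext _ _ (fun c => if o is Some r then c 0 (enum_rank r) else 0)).
  by move=> c; rewrite mxE.
by case: o => [r|]; [apply: polyfun_var | apply: polyfun_cst].
Qed.

(** A module is sent to its matrices on the normal words, which are coordinates of
    the module variety; the inverse is the extension of prescribed matrices. *)
Lemma quiver_variety_affine :
  isomorphic (quiver_variety k w) (affine_space k #|param|).
Proof.
pose f (M : quiver_variety k w) : affine_space k #|param| :=
  param_row (family_of M).
pose g (c : affine_space k #|param|) : quiver_variety k w :=
  module_of (extension_mesh (assignment c) levP).
exists f, g; split.
- move=> r; case Dr: (enum_val r) => [u [x [n [[[l i] j] p]]]].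
  pose idx : coord_index (quiver_variety k w) :=
    existT _ (val u, val x) (path_class k (val u) (val x)
      (loop_word (val u) (val x) (nword l)), (i, j)).
  exists (@PolynomialIn k _ 1 (fun=> idx) 'X_0) => M.
  rewrite [LHS]mxE Dr /peval /= mevalXU.
  done.
- case=> -[u v] [h [i j]].
  suff [P EP] : polyfun (fun c => act (g c) u v h i j).
    by exists (@PolynomialIn k 'I_#|param| #|param| id P) => c; apply: EP.
  move: i j; apply: polymx_sum => p; apply: polymxZ.
  by apply: ev_poly => *; apply: assignment_poly.
- move=> M; apply: module_eq => u x s ps.
  rewrite family_of_module_of //; apply/esym.
  apply: (mesh_system_unique levP) => //; first exact: family_of_mesh.
  by move=> {ps s x} u n l; rewrite assignment_row.
move=> c; rewrite /f /g -[RHS]param_row_extension.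
apply/rowP => r; rewrite !mxE; case: (enum_val r) => u [x [n [[[l i] j] p]]] /=.
rewrite family_of_module_of // -(eqP p); exact: nword_path.
Qed.

End Coordinates.

Theorem quiver_variety_is_affine_space :
  exists n, isomorphic (quiver_variety k w) (affine_space k n).
Proof.
have [N NP] := length_bound Qacyclic (finsupp w).
by exists #|param N|; apply: quiver_variety_affine.
Qed.

End Isomorphism.

Theorem corollary2p5 (R : realType) (Q : finquiver) :
  acyclic Q -> connected_quiver Q -> ~ dynkin Q ->
  forall w : dimvec Q,
    exists n : nat, isomorphic (quiver_variety R[i] w) (affine_space R[i] n).
Proof.
move=> Qacyclic Qconnected Qdynkin w.
have [d d_gt0 d_super] := exists_weights Qacyclic Qconnected Qdynkin.
exact: (quiver_variety_is_affine_space _ Qacyclic (levelsP _ d_gt0 d_super)).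
Qed.
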